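(* Let $\Omega=(a,b)$ be a finite interval, $0<\alpha<1$ and $1\le p<\infty$. Suppose that $\alpha p<1$. Then $W^{1,p}(\Omega)\subset{}^{\pm}W^{\alpha,p}(\Omega)$ for each choice of sign. Hence $W^{1,p}(\Omega)\subset W^{\alpha,p}(\Omega)$ when $\alpha p<1$.
   Context: Fractional integrals on $(a,b)$, for $\sigma>0$: ${}^{-}I^{\sigma}f(x)=\frac{1}{\Gamma(\sigma)}\int_a^x\frac{f(y)}{(x-y)^{1-\sigma}}\,dy$ and ${}^{+}I^{\sigma}f(x)=\frac{1}{\Gamma(\sigma)}\int_x^b\frac{f(y)}{(y-x)^{1-\sigma}}\,dy$. For $0<\alpha<1$: ${}^{-}D^{\alpha}\varphi=\frac{d}{dx}\,{}^{-}I^{1-\alpha}\varphi$ and ${}^{+}D^{\alpha}\varphi=-\frac{d}{dx}\,{}^{+}I^{1-\alpha}\varphi$. Weak fractional derivatives ($0<\alpha<1$): for $u\in L^1(\Omega)$, $v\in L^1_{loc}(\Omega)$ is the left (resp. right) weak fractional derivative of $u$, written ${}^{-}\mathcal{D}^{\alpha}u=v$ (resp. ${}^{+}\mathcal{D}^{\alpha}u=v$), if $\int_\Omega v\varphi\,dx=\int_\Omega u\,{}^{+}D^{\alpha}\varphi\,dx$ (resp. with ${}^{-}D^{\alpha}\varphi$ on the right-hand side) for all $\varphi\in C_0^\infty(\Omega)$. ${}^{\pm}W^{\alpha,p}(\Omega)=\{u\in L^p(\Omega):{}^{\pm}\mathcal{D}^{\alpha}u\in L^p(\Omega)\}$ and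 $W^{\alpha,p}(\Omega)={}^{-}W^{\alpha,p}(\Omega)\cap{}^{+}W^{\alpha,p}(\Omega)$ (for $0<\alpha<1$). $W^{1,p}(\Omega)$ is the usual integer order Sobolev space. *)

(* Defs.v *)
From HB Require Import structures.
From mathcomp Require Import all_boot all_order all_algebra.
From mathcomp Require Import all_classical all_reals all_analysis.

Set Implicit Arguments.
Unset Strict Implicit.
Unset Printing Implicit Defensive.

Import Order.TTheory GRing.Theory Num.Theory.
Import numFieldNormedType.Exports.

Local Open Scope classical_set_scope.
Local Open Scope ring_scope.

(* A function on Omega = ]a, b[ is represented by a total function R -> R whose
   values outside Omega are irrelevant, and a class of functions modulo a.e.
   equality by its Borel measurable representatives. *)

Definition Lp_on {R : realType} (D : set R) (p : R) : set (R -> R) :=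
  [set u : R -> R | (u \_ D : R -> R) \in Lfun (@lebesgue_measure R) p%:E].

(* The elements of C_0^oo(D), extended by zero to the whole line. *)
Definition test_function {R : realType} (D : set R) : set (R -> R) :=
  [set phi : R -> R |
    [/\ forall (n : nat) (x : R), derivable (derive1n n phi) x 1,
        compact (closure [set x | phi x != 0]) &
        closure [set x | phi x != 0] `<=` D]].

Definition Gamma {R : realType} (s : R) : R :=
  \int[@lebesgue_measure R]_(t in `]0, +oo[) (t `^ (s - 1) * expR (- t)).

Definition frac_int_left {R : realType} (a sigma : R) (f : R -> R) (x : R) : R :=
  (Gamma sigma)^-1 *
  \int[@lebesgue_measure R]_(y in `]a, x[) (f y / (x - y) `^ (1 - sigma)).

Definition frac_int_right {R : realType} (b sigma : R) (f : R -> R) (x : R) : R :=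
  (Gamma sigma)^-1 *
  \int[@lebesgue_measure R]_(y in `]x, b[) (f y / (y - x) `^ (1 - sigma)).

Definition frac_deriv_left {R : realType} (a alpha : R) (phi : R -> R) (x : R)
    : R :=
  derive1 (frac_int_left a (1 - alpha) phi) x.

Definition frac_deriv_right {R : realType} (b alpha : R) (phi : R -> R) (x : R)
    : R :=
  - derive1 (frac_int_right b (1 - alpha) phi) x.

(* The left weak derivative is tested against the right derivative of phi, and
   conversely. *)
Definition is_weak_frac_deriv_left {R : realType} (a b alpha : R)
    (u v : R -> R) : Prop :=
  [/\ Lp_on `]a, b[ 1 u, locally_integrable `]a, b[ v &
      forall phi, test_function `]a, b[ phi ->
        \int[@lebesgue_measure R]_(x in `]a, b[) (v x * phi x) =
        \int[@lebesgue_measure R]_(x in `]a, b[)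
          (u x * frac_deriv_right b alpha phi x)].

Definition is_weak_frac_deriv_right {R : realType} (a b alpha : R)
    (u v : R -> R) : Prop :=
  [/\ Lp_on `]a, b[ 1 u, locally_integrable `]a, b[ v &
      forall phi, test_function `]a, b[ phi ->
        \int[@lebesgue_measure R]_(x in `]a, b[) (v x * phi x) =
        \int[@lebesgue_measure R]_(x in `]a, b[)
          (u x * frac_deriv_left a alpha phi x)].

Definition frac_sobolev_left {R : realType} (a b alpha p : R) : set (R -> R) :=
  [set u : R -> R | Lp_on `]a, b[ p u /\
    exists2 v, is_weak_frac_deriv_left a b alpha u v & Lp_on `]a, b[ p v].

Definition frac_sobolev_right {R : realType} (a b alpha p : R) : set (R -> R) :=
  [set u : R -> R | Lp_on `]a, b[ p u /\
    exists2 v, is_weak_frac_deriv_right a b alpha u v & Lp_on `]a, b[ p v].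

Definition frac_sobolev {R : realType} (a b alpha p : R) : set (R -> R) :=
  frac_sobolev_left a b alpha p `&` frac_sobolev_right a b alpha p.

Definition is_weak_deriv {R : realType} (a b : R) (u v : R -> R) : Prop :=
  [/\ locally_integrable `]a, b[ u, locally_integrable `]a, b[ v &
      forall phi, test_function `]a, b[ phi ->
        \int[@lebesgue_measure R]_(x in `]a, b[) (u x * derive1 phi x) =
        - \int[@lebesgue_measure R]_(x in `]a, b[) (v x * phi x)].

(* W^{1,p}(]a, b[) *)
Definition sobolev1 {R : realType} (a b p : R) : set (R -> R) :=
  [set u : R -> R | Lp_on `]a, b[ p u /\
    exists2 v, is_weak_deriv a b u v & Lp_on `]a, b[ p v].

(* Main.v *)
(* Write [u'] for the weak derivative of [u], extended by zero, and let
   [k t = t^(-alpha)] on ]0, b - a[ and [k t = 0] elsewhere.  By the du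
   Bois-Reymond lemma, [u x = C + \int_a^x u'] almost everywhere, and the left
   weak fractional derivative of [u] is
     [v x = (C * k (x - a) + (u' * k) x) / Gamma (1 - alpha)],
   where the second [*] denotes a convolution.  Since [alpha * p < 1], both [k]
   and [k^p] are integrable, so both terms of [v] are in L^p.  For a test function
   [phi], the right fractional integral of [phi] is, up to the Gamma factor,
   [psi y = \int phi (y + t) k t dt] on ]a, b[; it can be differentiated under
   the integral sign and vanishes at [b], so two applications of Fubini's theorem
   turn both sides of the defining identity of [v] into
   [(C * psi a + \int u' psi) / Gamma (1 - alpha)].  The right-handed case is the
   mirror image of the left-handed one under [x |-> a + b - x]. *)

Require Import Defs.
From mathcomp Require Import all_boot all_order all_algebra.
From mathcomp Require Import all_classical all_reals all_analysis.
From mathcomp Require Import measurable_realfun ring lra.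

Import Order.TTheory GRing.Theory Num.Theory.
Import numFieldNormedType.Exports.

Local Open Scope classical_set_scope.
Local Open Scope ring_scope.

(** * Smooth functions *)

(** The hypothesis [alpha * p < 1] comes from the constants: [C] contributes a multiple of
    [(x - a)^(-alpha)], whose p-th power is integrable near [a] only for such exponents. Cutting [k]
    off at [b - a] makes it integrable on the whole line, and differences of points of ]a, b[ never
    reach the cutoff. Putting the dependence on [y] into [phi (y + t)] is what allows a singular
    integral to be differentiated: the derivative falls on [phi], and [k] need only be integrable.
    The du Bois-Reymond lemma calls for a supply of explicit test functions; these are
    [exp (- s / ((x - c) (d - x)))] on ]c, d[, which tend to the indicator of ]c, d[ as [s] tends to
    0, so that dominated convergence replaces mollification. Convolution with [k] and the primitive
    from [a] to [x] are both treated as integral operators on the whole line, with kernels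
    [k (x - y)] and the indicator of [y < x], so that one exchange lemma serves both. *)

Definition smooth {R : realType} (f : R -> R) :=
  forall (n : nat) (x : R), derivable (derive1n n f) x 1.

(** Smoothness can thus be proved without a formula for the n-th derivative, by exhibiting a family
    that contains the function and is stable under differentiation. *)
Lemma smooth_coind {R : realType} (P : set (R -> R)) :
  (forall f, P f -> (forall x, derivable f x 1) /\ P (derive1 f)) ->
  forall f, P f -> smooth f.
Proof.
move=> PD f Pf n; suff [] : (forall x, derivable (derive1n n f) x 1) /\ P (derive1n n f) by [].
elim: n => [|n [_ IH]]; first by split=> //; exact: (PD f Pf).1.
by have [d1 P1] := PD _ IH; split=> //; exact: (PD _ P1).1.
Qed.

Lemma is_derive_poly {R : realType} (q : {poly R}) (x : R) :
  is_derive x (1:R) (fun y => q.[y]) (q^`().[x]).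
Proof.
elim/poly_ind: q => [|q c IH].
  by rewrite deriv0 horner0; under eq_fun do rewrite horner0; exact: is_derive_cst.
rewrite derivD derivC addr0 derivM derivX mulr1 !hornerE.
under eq_fun do rewrite !hornerE.
by apply: is_derive_eq; rewrite /GRing.scale/=; ring.
Qed.

(* For fixed [s] and [P] this family is closed under differentiation; this is why
   its members are smooth. *)
Definition bump {R : realType} (s : R) (P q : {poly R}) (m : nat) (x : R) : R :=
  if 0 < P.[x] then q.[x] / P.[x] ^+ m * expR (- (s / P.[x])) else 0.

(* [e^y >= y^n / n!] makes every negative power of [P] harmless. *)
Lemma bump_le {R : realType} (s : R) (P q : {poly R}) (m : nat) (x : R) :
  0 < s -> `|bump s P q m x| <= (m.+2)`!%:R / s ^+ m.+2 * `|q.[x]| * P.[x] ^+ 2.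
Proof.
move=> s0; rewrite /bump; case: ifPn => [P0|_]; last first.
  rewrite normr0 mulr_ge0 ?sqr_ge0// mulr_ge0// mulr_ge0// invr_ge0.
  by rewrite exprn_ge0// ltW.
rewrite !normrM normfV normrX (gtr0_norm P0) (gtr0_norm (expR_gt0 _)).
have := @expR_ge1Dxn _ (s / P.[x]) m.+1 (divr_ge0 (ltW s0) (ltW P0)).
rewrite expRN; set E := expR _; set F := _`!%:R => h.
have F0 : 0 < F by rewrite /F ltr0n fact_gt0.
have E0 : 0 < E by exact: expR_gt0.
have {}h : s ^+ m.+2 / P.[x] ^+ m.+2 / F <= E.
  by rewrite -expr_div_n (le_trans _ h)// lerDr.
have S0 : 0 < s ^+ m.+2 by exact: exprn_gt0.
have Pm : 0 < P.[x] ^+ m by exact: exprn_gt0.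
rewrite !ler_pdivrMr ?exprn_gt0// in h.
rewrite -[leLHS]mulrA -invfM [_ / _ * `|_|]mulrC -[leRHS]mulrA ler_wpM2l//.
rewrite -div1r ler_pdivrMr ?mulr_gt0// -(ler_pM2r S0) mul1r (le_trans h)//.
rewrite le_eqVlt; apply/orP; left; apply/eqP.
have {S0} : s ^+ m.+2 != 0 by rewrite gt_eqF.
by move: (s ^+ m.+2) => S S0; rewrite -(addn2 m) exprD; field.
Qed.

(** Serves at the roots of [P], where the two branches of [bump] meet: the difference quotient is at
    most [|h| * g (h + x)], and [g] stays bounded near [x]. *)
Lemma is_derive0_quadratic {R : realType} (f g : R -> R) (x : R) :
  (forall y, `|f y| <= g y * (y - x) ^+ 2) -> {for x, continuous g} ->
  is_derive x 1 f 0.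
Proof.
move=> fg gx.
have fx0 : f x = 0.
  by apply/eqP; rewrite -normr_le0 (le_trans (fg x))// subrr expr0n mulr0.
suff h0 : h^-1 *: (f (h + x) - f x) @[h --> 0^'] --> (0 : R).
  have fE : (fun h => h^-1 *: ((f \o shift x) (h *: 1) - f x)) =
            (fun h : R => h^-1 *: (f (h + x) - f x)).
    by apply/funext => h /=; rewrite /GRing.scale/= mulr1.
  apply: DeriveDef; first by apply/cvg_ex; exists 0; rewrite fE.
  by apply/cvg_lim => //; rewrite fE.
have sqrE (c d : R) : c * d ^+ 2 = `|d| * (`|d| * c).
  by rewrite mulrA -expr2 -normrX ger0_norm ?sqr_ge0// mulrC.
apply: norm_cvg0; apply: (@squeeze_cvgr _ _ _ _ (cst 0) (fun h => `|h| * g (h + x))).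
- near=> h; rewrite normr_ge0 /= fx0 subr0 /GRing.scale/= normrM normfV.
  have h0 : h != 0 by near: h; exact: nbhs_dnbhs_neq.
  rewrite ler_pdivrMl ?normr_gt0// (le_trans (fg _))// addrK.
  by rewrite sqrE.
- exact: cvg_cst.
- rewrite [X in _ --> X](_ : _ = `|(0 : R)| * g (0 + x)); last by rewrite normr0 mul0r.
  apply: cvgM; apply: cvg_within_filter.
    exact: norm_continuous.
  apply: (@cvg_comp _ _ _ (fun h => h + x) g _ (nbhs (0 + x))).
    apply: cvgD; [exact: cvg_id|exact: cvg_cst].
  by rewrite add0r.
Unshelve. all: end_near. Qed.

Lemma is_derive_bump {R : realType} (s : R) (P q : {poly R}) (m : nat) (x : R) :
  0 < s ->
  is_derive x 1 (bump s P q m)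
    (bump s P (q^`() * P ^+ 2 - m%:R *: (q * P^`() * P) + s *: (q * P^`())) m.+2 x).
Proof.
move=> s0; have dP := is_derive_poly P x; have dq := is_derive_poly q x.
have cP : {for x, continuous (horner P)} by apply: continuous_horner.
have [P0|P0|P0] := ltgtP P.[x] 0.
- have -> : bump s P (q^`() * P ^+ 2 - m%:R *: (q * P^`() * P) + s *: (q * P^`()))
     m.+2 x = 0 by rewrite /bump ltNge ltW.
  apply: (@near_eq_is_derive _ _ _ (cst 0)) => //.
    near=> y; rewrite /bump ltNge ltW//; near: y.
    exact: (cvgr_lt _ cP).
- have PN : P.[x] != 0 by rewrite gt_eqF.
  apply: (@near_eq_is_derive _ _ _
    (fun y => q.[y] / (P ^+ m).[y] * expR (- (s / P.[y])))) => //.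
    near=> y; rewrite /bump horner_exp; case: ifPn => // /negP[]; near: y.
    exact: (cvgr_gt _ cP).
  rewrite /bump P0.
  have PmN : (P ^+ m).[x] != 0 by rewrite horner_exp expf_neq0.
  have dPV := is_deriveV PN dP.
  have dPmV := is_deriveV PmN (is_derive_poly (P ^+ m) x).
  apply: is_derive_eq.
  rewrite deriv_exp hornerMn hornerM !horner_exp !hornerE /GRing.scale/=.
  rewrite horner_exp in PmN.
  (* The exponent [m.-1] comes from differentiating [P ^+ m]; hence the separate case [m = 0]. *)
  have fieldE (u u' w w' e : R) : w != 0 ->
      u / w ^+ m * (e * - (s * (- w ^- 2 * w'))) +
      e * (u * (- w ^+ m ^- 2 * (w' * w ^+ m.-1 *+ m)) + w ^- m * u') =
      (u' * w * w - m%:R * u * w' * w + s * u * w') / w ^+ m.+2 * e.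
    move=> w0; case: (m) => [|n] /=; first by rewrite mulr0n; field.
    by rewrite -mulr_natr !exprS; field; rewrite w0 expf_neq0.
  exact: fieldE.
- have -> : bump s P (q^`() * P ^+ 2 - m%:R *: (q * P^`() * P) + s *: (q * P^`()))
     m.+2 x = 0 by rewrite /bump P0 ltxx.
  (* The root splits a factor [y - x] off [P.[y]], so the factor [P.[y] ^+ 2] in [bump_le] supplies
     the quadratic bound. *)
  have /factor_theorem[P1 PE] : root P x by apply/rootP.
  apply: (@is_derive0_quadratic _ _
    (fun y => (m.+2)`!%:R / s ^+ m.+2 * `|q.[y]| * P1.[y] ^+ 2)).
    move=> y; rewrite (le_trans (bump_le _ _ _ _ _ s0))//.
    have -> : P.[y] = P1.[y] * (y - x) by rewrite PE hornerM hornerXsubC.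
    by rewrite exprMn mulrA.
  apply: cvgM; last by apply: cvgM; exact: continuous_horner.
  by apply: cvgM; [exact: cvg_cst|apply: cvg_norm; exact: continuous_horner].
Unshelve. all: end_near. Qed.

Lemma smooth_bump {R : realType} (s : R) (P q : {poly R}) (m : nat) :
  0 < s -> smooth (bump s P q m).
Proof.
move=> s0; pose F := [set f | exists q m, f = bump s P q m].
apply: (smooth_coind F); last by exists q, m.
move=> f [q1 [m1 ->]]; split; first by move=> x; have [] := is_derive_bump s P q1 m1 x s0.
exists (q1^`() * P ^+ 2 - m1%:R *: (q1 * P^`() * P) + s *: (q1 * P^`())), m1.+2.
by apply/funext => x; rewrite derive1E; have [_ ->] := is_derive_bump s P q1 m1 x s0.
Qed.

(** * Translations and reflections *)

Section measure_preserving.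
Context {R : realType}.
Notation mu := (@lebesgue_measure R).
Variable phi : R -> R.
Hypothesis mphi : measurable_fun [set: R] phi.
Hypothesis mu_phi : forall A, measurable A -> mu (phi @^-1` A) = mu A.

Lemma ge0_integral_preserving (F : R -> \bar R) :
  measurable_fun [set: R] F -> (forall x, (0 <= F x)%E) ->
  (\int[mu]_x F (phi x) = \int[mu]_x F x)%E.
Proof.
move=> mF F0; pose mR := measurableTypeR R.
rewrite -[X in integral _ X _ = _](preimage_setT (phi : mR -> mR)).
rewrite -(@ge0_integral_pushforward _ _ mR mR R phi mphi mu setT F)//.
apply: eq_measure_integral => A mA _.
exact: mu_phi.
Qed.

Lemma integral_preserving (F : R -> \bar R) : measurable_fun [set: R] F ->
  (\int[mu]_x F (phi x) = \int[mu]_x F x)%E.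
Proof.
move=> mF; rewrite integralE [RHS]integralE; congr (_ - _)%E.
- rewrite -[RHS](ge0_integral_preserving F^\+)%E.
  + by apply: eq_integral => x _; rewrite 2!funeposE.
  + exact: measurable_funepos.
  + by move=> x; exact: funepos_ge0.
- rewrite -[RHS](ge0_integral_preserving F^\-)%E.
  + by apply: eq_integral => x _; rewrite 2!funenegE.
  + exact: measurable_funeneg.
  + by move=> x; exact: funeneg_ge0.
Qed.

Lemma integrable_preserving (F : R -> \bar R) :
  mu.-integrable setT F -> mu.-integrable setT (F \o phi).
Proof.
move=> /integrableP[mF iF]; apply/integrableP; split.
  exact: (measurableT_comp mF mphi).
rewrite (@ge0_integral_preserving (fun x => `|F x|)%E)//.
exact: measurableT_comp.
Qed.

End measure_preserving.

Section affine.
Context {R : realType}.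
Notation mu := (@lebesgue_measure R).

Lemma measurable_shift (c : R) : measurable_fun [set: R] (fun x : R => x + c).
Proof. exact: measurable_funD. Qed.

Lemma measurable_reflect (c : R) : measurable_fun [set: R] (fun x : R => c - x).
Proof. exact: measurable_funB. Qed.

(** Lebesgue measure is determined by its values on the intervals ]a, b], so the image measure has
    to be compared with it only there. *)
Lemma lebesgue_measure_shift (c : R) (A : set R) : measurable A ->
  mu ((fun x => x + c) @^-1` A) = mu A.
Proof.
move=> mA; have -> : mu ((fun x => x + c) @^-1` A) =
    pushforward mu ((fun x => x + c) : _ -> measurableTypeR R) A by [].
apply/esym/lebesgue_measure_unique => //=; first exact: measurable_shift.
move=> mT _ [[a b]] _ <-; rewrite /pushforward.
have -> : (fun x => x + c) @^-1` `]a, b]%classic = `]a - c, b - c]%classic.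
  by apply/seteqP; split=> x; rewrite /= !in_itv/= ltrBlDr lerBrDr.
rewrite !lebesgue_measure_itv/= !lte_fin ltrD2r -!EFinB.
by congr (if _ then _%:E else _); ring.
Qed.

Lemma lebesgue_measure_reflect (c : R) (A : set R) : measurable A ->
  mu ((fun x => c - x) @^-1` A) = mu A.
Proof.
move=> mA; have -> : mu ((fun x => c - x) @^-1` A) =
    pushforward mu ((fun x => c - x) : _ -> measurableTypeR R) A by [].
apply/esym/lebesgue_measure_unique => //=; first exact: measurable_reflect.
move=> mT _ [[a b]] _ <-; rewrite /pushforward.
have -> : (fun x => c - x) @^-1` `]a, b]%classic = `[c - b, c - a[%classic.
  apply/seteqP; split=> x; rewrite /= !in_itv/= => /andP[] h1 h2; apply/andP; split; lra.
rewrite !lebesgue_measure_itv/= !lte_fin ltrD2l ltrN2 -!EFinB.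
by congr (if _ then _%:E else _); ring.
Qed.

End affine.

(** * Integral operators with a kernel *)

Section kernel.
Context {R : realType}.
Notation mu := (@lebesgue_measure R).
(* The measure lives on this alias of [R]; stating measurability on [R] itself
   makes unification of the measurable structures fail. *)
Let mR := measurableTypeR R.
Implicit Types (f g : R -> R) (H : mR * mR -> R).

(** Passing from the extended-valued inner integral to its [fine] part changes it only where it is
    infinite, which is a null set by integrability. *)
Lemma Rintegral_fubini_F H :
  (mu \x mu)%E.-integrable [set: mR * mR] (EFin \o H) ->
  mu.-integrable setT (EFin \o (fun x => \int[mu]_y H (x, y))) /\
  \int[mu]_x \int[mu]_y H (x, y) =
  fine (\int[mu]_x \int[mu]_y (H (x, y))%:E)%E.
Proof.
move=> iH; have iF := integrable_fubini_F iH.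
have FE : {ae mu, forall x, [set: mR] x ->
    (\int[mu]_y H (x, y))%:E = fubini_F mu (EFin \o H) x}.
  have := integrable_ae measurableT iF; apply: filterS => x /= /(_ I) h _.
  by rewrite /Rintegral fineK.
have mF : measurable_fun [set: mR] (fun x => (\int[mu]_y H (x, y))%:E).
  apply/measurable_EFinP.
  have := measurable_int _ iF => mF.
  by apply: (measurableT_comp _ mF).
split.
  move: (iF) => /integrableP[mF' iF']; apply/integrableP; split => //.
  apply: le_lt_trans iF'; rewrite le_eqVlt; apply/orP; left; apply/eqP.
  apply: ae_eq_integral => //.
  - exact: measurableT_comp.
  - exact: measurableT_comp.
  - move: (FE); apply: filterS.
    by move=> x h _; exact: (congr1 abse (h I)).
congr fine.
by apply: ae_eq_integral => //; exact: measurable_int iF.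
Qed.

(* No integrability is needed: where the inner integral is undefined, [fine]
   returns a junk value in a measurable way. *)
Lemma measurable_Rintegral H : measurable_fun [set: mR * mR] H ->
  measurable_fun [set: mR] (fun x => \int[mu]_y H (x, y)).
Proof.
move=> mH; have mEH : measurable_fun [set: mR * mR] (EFin \o H) by exact/measurable_EFinP.
have mE : measurable_fun [set: mR] (fun x => \int[mu]_y (H (x, y))%:E)%E.
  have -> : (fun x => \int[mu]_y (H (x, y))%:E)%E =
      (fubini_F mu (EFin \o H)^\+ \- fubini_F mu (EFin \o H)^\-)%E.
    apply/funext => x; rewrite [LHS]integralE /fubini_F.
    by congr (_ - _)%E; apply: eq_integral => y _; rewrite ?funeposE ?funenegE.
  apply: emeasurable_funB; apply: measurable_fun_fubini_tonelli_F => //.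
  - exact: measurable_funepos.
  - exact: measurable_funeneg.
exact: (measurableT_comp _ mE).
Qed.

Lemma Rintegral_swap H :
  (mu \x mu)%E.-integrable [set: mR * mR] (EFin \o H) ->
  \int[mu]_x \int[mu]_y H (x, y) = \int[mu]_y \int[mu]_x H (x, y).
Proof.
move=> iH; have mH := measurable_int _ iH.
pose H' (z : mR * mR) := H (z.2, z.1).
have iH' : (mu \x mu)%E.-integrable [set: mR * mR] (EFin \o H').
  apply/integrable12ltyP; last by move/integrable21ltyP : iH; exact.
  by apply: (measurableT_comp mH); exact: measurable_swap.
rewrite (Rintegral_fubini_F _ iH).2 (Rintegral_fubini_F _ iH').2.
by congr fine; exact: (Fubini iH).
Qed.

(** Integrating in [x] first leaves at most [M * |f y|]; Tonelli then gives absolute integrability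
    on the plane. *)
Lemma integrable_kernel f H (M : R) :
  mu.-integrable setT (EFin \o f) -> measurable_fun [set: mR * mR] H ->
  (forall y, (\int[mu]_x `|H (x, y)|%:E <= M%:E)%E) ->
  (mu \x mu)%E.-integrable [set: mR * mR] (EFin \o (fun z => f z.2 * H z)).
Proof.
move=> /integrableP[/measurable_EFinP mf fi] mH HM.
have M0 : 0 <= M.
  by rewrite -lee_fin (le_trans _ (HM 0))// integral_ge0// => x _; rewrite lee_fin.
apply/integrable21ltyP.
  apply/measurable_EFinP; apply: measurable_funM => //.
  by apply: (measurableT_comp mf); exact: measurable_snd.
apply: (@le_lt_trans _ _ (\int[mu]_y (`|f y|%:E * M%:E))%E).
  have mHy y : measurable_fun [set: mR] (fun x => H (x, y)).
    by apply: (measurableT_comp mH); exact: measurable_pair2.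
  apply: ge0_le_integral => //.
  - by move=> y _; apply: integral_ge0.
  - apply: (measurable_fun_fubini_tonelli_G (fun z : mR * mR => `|(f z.2 * H z)%:E|)%E) => //.
    apply: measurableT_comp => //; apply/measurable_EFinP/measurable_funM => //.
    by apply: (measurableT_comp mf); exact: measurable_snd.
  - by apply/measurable_EFinP; apply: measurable_funM => //; exact: measurableT_comp.
  move=> y _; under eq_integral do rewrite /= normrM EFinM.
  rewrite ge0_integralZl//; last first.
    by apply/measurable_EFinP; apply: measurableT_comp.
  by rewrite lee_wpmul2l.
rewrite ge0_integralZr//; last first.
  by apply/measurable_EFinP; apply: measurableT_comp.
by rewrite muleC lte_mul_pinfty// lee_fin.
Qed.

(** The weight [g] is part of the bound so that both uses fit: for [convolution], [g] is bounded and
    the kernel integrable; for [primitive], [g] is integrable and the kernel bounded. *)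
Lemma kernel_swap f g H (M : R) :
  mu.-integrable setT (EFin \o f) -> measurable_fun [set: mR] g ->
  measurable_fun [set: mR * mR] H ->
  (forall y, (\int[mu]_x `|g x * H (x, y)|%:E <= M%:E)%E) ->
  mu.-integrable setT (EFin \o (fun x => g x * \int[mu]_y (f y * H (x, y)))) /\
  \int[mu]_x (g x * \int[mu]_y (f y * H (x, y))) =
  \int[mu]_y (f y * \int[mu]_x (g x * H (x, y))).
Proof.
move=> fi mg mH HM; pose K (z : mR * mR) := g z.1 * H z.
have mK : measurable_fun [set: mR * mR] K.
  by apply: measurable_funM => //; apply: (measurableT_comp mg); exact: measurable_fst.
have iK := integrable_kernel _ _ _ fi mK HM.
have [iF _] := Rintegral_fubini_F _ iK; have swap := Rintegral_swap _ iK.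
have mFK := measurable_int _ iF.
have mHx x : measurable_fun [set: mR] (fun y => H (x, y)).
  by apply: (measurableT_comp mH); exact: measurable_pair1.
have gFE : {ae mu, forall x : mR, [set: mR] x ->
    (\int[mu]_y (f y * K (x, y))) = g x * \int[mu]_y (f y * H (x, y))}.
  have := ae_integrable1 iK; apply: filterS => x /= ix _.
  (* Only [g x * f y * H (x, y)] is known to be integrable in [y]. Dividing by [g x] gives linearity
     when it is nonzero; otherwise both sides are 0 outright. *)
  have [gx0|gx0] := eqVneq (g x) 0.
    rewrite gx0 mul0r; under eq_Rintegral do rewrite /K /= gx0 mul0r mulr0.
    by rewrite Rintegral_cst// mul0r.
  rewrite -RintegralZl//.
    by apply: eq_Rintegral => y _; rewrite /K /=; ring.
  have := integrableZl measurableT (g x)^-1 ix; apply: eq_integrable => // y _.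
  by rewrite /K /= -EFinM; congr EFin; field.
have mgF : measurable_fun [set: mR] (fun x => g x * \int[mu]_y (f y * H (x, y))).
  apply: measurable_funM => //; apply: (measurable_Rintegral (fun z => f z.2 * H z)).
  apply: measurable_funM => //; apply: measurableT_comp; last exact: measurable_snd.
  by apply/measurable_EFinP; exact: measurable_int fi.
split.
  move: (iF) => /integrableP[_ iF']; apply/integrableP; split; first exact/measurable_EFinP.
  apply: le_lt_trans iF'; rewrite le_eqVlt; apply/orP; left; apply/eqP.
  apply: ae_eq_integral => //.
  - by apply: measurableT_comp => //; exact/measurable_EFinP.
  - exact: measurableT_comp.
  - by move: gFE; apply: filterS => x h _; rewrite /= (h I).
rewrite [RHS](_ : _ = \int[mu]_y \int[mu]_x (f y * K (x, y))); last first.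
  apply: eq_Rintegral => y _; rewrite RintegralZl//.
  apply/integrableP; split; last exact: le_lt_trans (HM y) (ltry _).
  apply/measurable_EFinP; apply: (measurableT_comp mK); exact: measurable_pair2.
rewrite -swap; congr fine; apply: ae_eq_integral => //.
- by apply/measurable_EFinP.
- by move: gFE; apply: filterS => x h _; rewrite (h I).
Qed.

End kernel.

(** * The truncated power kernel and its integrability *)

Section power_kernel.
Context {R : realType}.
Notation mu := (@lebesgue_measure R).

Definition power_kernel (s L t : R) : R := if 0 < t < L then t `^ (- s) else 0.

Lemma power_kernel_ge0 s L t : 0 <= power_kernel s L t.
Proof. by rewrite /power_kernel; case: ifP => // _; exact: powR_ge0. Qed.

Lemma measurable_power_kernel s L : measurable_fun [set: R] (power_kernel s L).
Proof.
have -> : power_kernel s L = (fun t => t `^ (- s)) \_ `]0, L[.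
  by apply/funext => t; rewrite /power_kernel patchE mem_setE in_itv.
apply/(measurable_restrictT _ _).1 => //.
exact: measurable_funTS (measurable_powR _).
Qed.

(** Reduces the L^p theory of the kernel to plain integrability at the exponent [s * p]. *)
Lemma power_kernel_powR s L p t : 0 < p ->
  power_kernel s L t `^ p = power_kernel (s * p) L t.
Proof.
move=> p0; rewrite /power_kernel; case: ifP => _.
  by rewrite -powRrM mulNr.
by rewrite powR0// gt_eqF.
Qed.

Lemma integral_powR_le s (e L : R) : 0 < e -> e < L -> s < 1 ->
  (\int[mu]_(t in `[e, L]) (t `^ (- s))%:E <= (L `^ (1 - s) / (1 - s))%:E)%E.
Proof.
move=> e0 eL s1; have s0 : 1 - s != 0 by rewrite subr_eq0 gt_eqF.
pose F t : R := t `^ (1 - s) / (1 - s).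
have dF (t : R) : 0 < t -> is_derive t 1 F (t `^ (- s)).
  move=> t0; rewrite /F.
  have h : is_derive t 1 (fun x : R => x `^ (1 - s)) ((1 - s) * t `^ (- s)).
    apply: DeriveDef; first by apply: derivable_powR; rewrite in_itv/= t0.
    rewrite -derive1E powR_derive1 ?in_itv/= ?t0//.
    by rewrite addrAC subrr sub0r.
  by apply: is_derive_eq; rewrite /GRing.scale/=; field.
have cf : {within `[e, L], continuous (fun t : R => t `^ (- s))}.
  apply: derivable_within_continuous => t; rewrite in_itv/= => /andP[et _].
  by apply: derivable_powR; rewrite in_itv/= (lt_le_trans e0 et).
have cF : {within `[e, L], continuous F}.
  apply: derivable_within_continuous => t; rewrite in_itv/= => /andP[et _].
  by have [] := dF t (lt_le_trans e0 et).
rewrite (@continuous_FTC2 _ _ F)//.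
- by rewrite -EFinB lee_fin gerBl divr_ge0 ?powR_ge0// subr_ge0 ltW.
- have [_ Fe FL] := (continuous_within_itvP _ eL).1 cF.
  split => // t; rewrite in_itv/= => /andP[et _].
  by have [] := dF t (lt_trans e0 et).
- move=> t; rewrite in_itv/= => /andP[et _].
  by rewrite derive1E; have [_ ->] := dF t (lt_trans e0 et).
Qed.

Lemma integrable_power_kernel (s L : R) : 0 < L -> s < 1 ->
  mu.-integrable setT (EFin \o power_kernel s L).
Proof.
move=> L0 s1; apply/integrableP; split.
  by apply/measurable_EFinP; exact: measurable_power_kernel.
apply: (@le_lt_trans _ _ (L `^ (1 - s) / (1 - s))%:E); last exact: ltry.
(* With [n.+2] the left end is strictly below [L] already for [n = 0], as [integral_powR_le]
   requires. *)
pose A (n : nat) := `[L / n.+2%:R, L]%classic.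
have -> : (\int[mu]_x `|(EFin \o power_kernel s L) x| =
    \int[mu]_(t in `]0%R, L[) (t `^ (- s))%:E)%E.
  rewrite [RHS]integral_mkcond; apply: eq_integral => t _.
  rewrite patchE mem_setE in_itv /= ger0_norm ?power_kernel_ge0//.
  by rewrite /power_kernel; case: ifP.
have mf D : measurable D -> measurable_fun D (fun t : R => (t `^ (- s))%:E).
  by move=> mD; apply/measurable_EFinP/measurable_funTS; exact: measurable_powR.
have f0 D (t : R) : D t -> (0 <= (t `^ (- s))%:E)%E.
  by move=> _; rewrite lee_fin powR_ge0.
apply: (@le_trans _ _ (\int[mu]_(t in \bigcup_n A n) (t `^ (- s))%:E)%E).
  apply: ge0_subset_integral => //=.
  - by apply: bigcup_measurable => n _; exact: measurable_itv.
  - by apply: mf; apply: bigcup_measurable => n _; exact: measurable_itv.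
  - by move=> t _; rewrite lee_fin powR_ge0.
  - move=> t; rewrite /= in_itv/= => /andP[t0 tL].
    (* For this [n], [L / t < n + 1 <= n + 2], hence [L / (n + 2) <= t]. *)
    exists (Num.trunc (L / t)) => //=; rewrite /A /= in_itv/= (ltW tL) andbT.
    rewrite ler_pdivrMr// mulrC -ler_pdivrMr//.
    have := truncnS_gt (L / t) => /ltW /le_trans; apply.
    by rewrite ler_nat.
apply: cvge_le; last apply: ge0_nondecreasing_set_cvg_integral.
- exact: eventually_filter.
- apply: nearW => n; apply: integral_powR_le => //.
    by rewrite divr_gt0.
  by rewrite ltr_pdivrMr// ltr_pMr// ltr1n.
- apply/nondecreasing_seqP => n; apply/subsetPset/subset_itvr.
  by rewrite bnd_simp ler_pM2l// lef_pV2 ?posrE// ler_nat.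
- by move=> n; exact: measurable_itv.
- by move=> n; apply: mf; exact: measurable_itv.
- by move=> n; exact: f0.
Qed.

End power_kernel.

(** * Compactly supported smooth functions and their correlations with a kernel *)

Section smooth_compact.
Context {R : realType}.
Notation mu := (@lebesgue_measure R).
Implicit Types (phi f k : R -> R).

Lemma smooth_derivable f : smooth f -> forall x, derivable f x 1.
Proof. by move=> sf; exact: (sf 0%N). Qed.

Lemma smooth_is_derive f (x : R) : smooth f -> is_derive x 1 f (f^`()%classic x).
Proof. by move=> sf; apply: DeriveDef; [exact: smooth_derivable|rewrite derive1E]. Qed.

Lemma smooth_derive1 f : smooth f -> smooth f^`()%classic.
Proof. by move=> sf n x; have := sf n.+1 x; rewrite derive1Sn. Qed.

Lemma smooth_continuous f : smooth f -> continuous f.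
Proof.
move=> sf x; apply/differentiable_continuous/derivable1_diffP.
exact: smooth_derivable.
Qed.

Lemma smooth_measurable f : smooth f -> measurable_fun [set: R] f.
Proof. by move=> /smooth_continuous; exact: continuous_measurable_fun. Qed.

Lemma smooth_primitive f g : (forall x : R, is_derive x 1 f (g x)) -> smooth g ->
  smooth f.
Proof.
move=> df sg [|n] x; first by have [] := df x.
rewrite derive1Sn (_ : f^`()%classic = g); first exact: sg.
by apply/funext => y; rewrite derive1E; have [_ ->] := df y.
Qed.

Lemma derive1_eq0_outside (a b : R) f : (forall x, ~~ (a <= x <= b) -> f x = 0) ->
  forall x, ~~ (a <= x <= b) -> f^`()%classic x = 0.
Proof.
move=> f0 x xab; rewrite derive1E -(derive_cst (0 : R) x 1).
apply: near_eq_derive => //; move: xab; rewrite negb_and -!ltNge => /orP[xa|bx].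
- by near=> y; apply: f0; rewrite negb_and -ltNge; apply/orP; left; near: y; exact: lt_nbhsl.
- by near=> y; apply: f0; rewrite negb_and -!ltNge; apply/orP; right; near: y; exact: lt_nbhsr.
Unshelve. all: end_near. Qed.

Lemma bounded_eq0_outside (a b : R) f : a <= b -> continuous f ->
  (forall x, ~~ (a <= x <= b) -> f x = 0) -> exists2 M, 0 <= M & forall x, `|f x| <= M.
Proof.
move=> ab cf f0; have cnf : {within `[a, b], continuous (fun x => `|f x|)}.
  apply: continuous_subspaceT => x; exact: (continuous_comp (cf x) (@norm_continuous _ _ _)).
have [c _ fc] := EVT_max ab cnf; exists `|f c| => // x.
have [xab|/f0 ->] := boolP (a <= x <= b); first by apply: fc; rewrite in_itv.
by rewrite normr0.
Qed.

(** This is the integral of [phi x * k (x - y)] after the substitution [x = y + t], which frees the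
    possibly singular factor from [y]. *)
Definition correlation k phi (y : R) : R := \int[mu]_t (phi (y + t) * k t).

Lemma integrable_bounded_mul f k (M : R) : mu.-integrable setT (EFin \o k) ->
  measurable_fun [set: R] f -> (forall x, `|f x| <= M) ->
  mu.-integrable setT (EFin \o (fun t => f t * k t)).
Proof.
move=> ik mf fM; have M0 : 0 <= M := le_trans (normr_ge0 _) (fM 0).
have mk : measurable_fun [set: R] k by apply/measurable_EFinP; exact: measurable_int ik.
apply: (le_integrable measurableT _ _ (integrableZl measurableT M ik)).
  by apply/measurable_EFinP; exact: measurable_funM.
by move=> x _ /=; rewrite lee_fin !normrM (ger0_norm M0) ler_wpM2r.
Qed.

(** The domination is by [N * |k t|], where [N] bounds the derivative of [phi]: that derivative is
    continuous and vanishes outside [a, b]. *)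
Lemma is_derive_correlation (a b : R) k phi (y : R) : a <= b -> smooth phi ->
  (forall x, ~~ (a <= x <= b) -> phi x = 0) ->
  mu.-integrable setT (EFin \o k) ->
  is_derive y 1 (correlation k phi) (correlation k phi^`()%classic y).
Proof.
move=> ab sphi phi0 ik.
have [M M0 phiM] := bounded_eq0_outside _ _ _ ab (smooth_continuous _ sphi) phi0.
have [N N0 dphiN] := bounded_eq0_outside _ _ _ ab
  (smooth_continuous _ (smooth_derive1 _ sphi)) (derive1_eq0_outside _ _ _ phi0).
have dphi (x t : R) : is_derive x 1 (fun z => phi (z + t) * k t) (phi^`()%classic (x + t) * k t).
  have dt := smooth_is_derive _ (x + t) sphi.
  have d1 := @is_derive1_comp _ phi (fun z => z + t) x _ _ dt _.
  by apply: is_derive_eq; rewrite /GRing.scale/=; ring.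
pose f (x t : R) := phi (x + t) * k t.
have dfE x t : partial1of2 f x t = phi^`()%classic (x + t) * k t.
  by rewrite partial1of2E; have [_ ->] := dphi x t.
have Iy : `](y - 1), (y + 1)[%classic y by rewrite /= in_itv/= ltrBlDr ltrDl ltr01.
have fi x : `](y - 1), (y + 1)[%classic x -> mu.-integrable setT (EFin \o f x).
  move=> _; apply: (@integrable_bounded_mul (fun t => phi (x + t)) k M) => //.
  apply: measurableT_comp; first exact: smooth_measurable.
  exact: measurable_funD.
have fd x t : `](y - 1), (y + 1)[%classic x -> [set: R] t -> derivable (f ^~ t) x 1.
  by move=> _ _; have [] := dphi x t.
have G0 (t : R) : 0 <= N * `|k t| by rewrite mulr_ge0.
have iG : mu.-integrable setT (EFin \o (fun t => N * `|k t|)).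
  exact: (integrableZl measurableT N (integrable_norm ik)).
have Gub x t : `](y - 1), (y + 1)[%classic x -> [set: R] t -> `|partial1of2 f x t| <= N * `|k t|.
  by move=> _ _; rewrite dfE normrM ler_wpM2r.
have cvgd := cvg_differentiation_under_integral measurableT Iy fi fd G0 iG Gub.
have cE : correlation k phi^`()%classic y = \int[mu]_t partial1of2 f y t.
  by apply: eq_Rintegral => t _; rewrite dfE.
have hE : (fun h => h^-1 *: ((correlation k phi \o shift y) (h *: 1) - correlation k phi y)) =
            (fun h : R => h^-1 *: (correlation k phi (h + y) - correlation k phi y)).
  by apply/funext => h /=; rewrite /GRing.scale/= mulr1.
rewrite cE; apply: DeriveDef; first by apply/cvg_ex; eexists; rewrite hE; exact: cvgd.
by apply/cvg_lim => //; rewrite hE; exact: cvgd.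
Qed.

End smooth_compact.

(** * L^p bounds for convolutions *)

Section Lp.
Context {R : realType}.
Notation mu := (@lebesgue_measure R).
Let mR := measurableTypeR R.
Implicit Types (f u k : R -> R) (D : set R).

Lemma LfunP (p : R) f : 1 <= p ->
  f \in Lfun mu p%:E <->
  measurable_fun [set: mR] f /\ (\int[mu]_x (`|f x| `^ p)%:E < +oo)%E.
Proof.
move=> p1; have p0 : 0 < p := lt_le_trans ltr01 p1.
have powE : (\int[mu]_x `|(EFin \o f) x| `^ p = \int[mu]_x (`|f x| `^ p)%:E)%E.
  by apply: eq_integral.
split.
- rewrite inE => /andP[/[1!inE]/= mf]; rewrite inE /= /finite_norm unlock /= powE.
  by move=> h; split => //; move: h; apply: lty_poweRy; rewrite invr_eq0 gt_eqF.
- move=> [mf h]; rewrite inE; apply/andP; split; rewrite inE //= /finite_norm unlock /= powE.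
  exact: poweR_lty.
Qed.

(** Pointwise [|u| <= 1 + |u|^p], and the constant 1 is integrable on a bounded interval. *)
Lemma Lp_on_integrable (a b p : R) u : 1 <= p -> Lp_on `]a, b[ p u ->
  mu.-integrable setT (EFin \o (u \_ `]a, b[)).
Proof.
move=> p1; rewrite /Lp_on /= => /(LfunP _ _ p1)[mu_ upoo].
have iup : mu.-integrable setT (fun x => (`|(u \_ `]a, b[) x| `^ p)%:E).
  apply/integrableP; split.
    apply/measurable_EFinP; apply: (measurableT_comp (measurable_powR p)).
    exact: measurableT_comp.
  by under eq_integral do rewrite gee0_abs ?lee_fin ?powR_ge0//.
apply: (le_integrable measurableT _ _ (integrableD measurableT
  (integrable_indic_itv a b false true) iup)).
  exact/measurable_EFinP.
move=> x _ /=; rewrite lee_fin [leRHS]ger0_norm ?addr_ge0 ?powR_ge0//.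
rewrite indicE patchE; case: ifPn => xab; last by rewrite normr0 addr_ge0// powR_ge0.
have [u1|u1] := leP `|u x| 1; first by rewrite ler_wpDr// powR_ge0.
by rewrite ler_wpDl// le1r_powR// ltW.
Qed.

Lemma measurable_convolution_kernel k : measurable_fun [set: mR] k ->
  measurable_fun [set: mR * mR] (fun z => k (z.1 - z.2)).
Proof.
move=> mk; apply: (measurableT_comp mk).
by apply: measurable_funB; [exact: measurable_fst|exact: measurable_snd].
Qed.

Lemma integral_convolution_kernel k (y : R) : measurable_fun [set: mR] k ->
  (\int[mu]_x `|k (x - y)|%:E = \int[mu]_x `|k x|%:E)%E.
Proof.
move=> mk.
have := @ge0_integral_preserving _ _ (measurable_shift (- y))
  (lebesgue_measure_shift (- y)) (fun x => `|k x|%:E)%E; apply => //.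
by apply/measurable_EFinP; exact: measurableT_comp.
Qed.

Lemma integrable_convolution_kernel f k :
  mu.-integrable setT (EFin \o f) -> mu.-integrable setT (EFin \o k) ->
  (mu \x mu)%E.-integrable [set: mR * mR]
    (EFin \o (fun z => f z.2 * k (z.1 - z.2))).
Proof.
move=> fi ki; have mk : measurable_fun [set: mR] k.
  by apply/measurable_EFinP; exact: measurable_int ki.
apply: (integrable_kernel _ _ (fine (\int[mu]_x `|k x|%:E)%E) fi).
  exact: measurable_convolution_kernel.
move=> y; rewrite /= integral_convolution_kernel// fineK//.
by move/integrableP : ki => [_]; rewrite ge0_fin_numE// integral_ge0.
Qed.

Definition convolution f k (x : R) : R := \int[mu]_y (f y * k (x - y)).

(* The bound comes from [t <= m + m^(1 - p) t^p] with [m^p = J + 1]; it avoids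
   the case analysis of Hoelder's inequality at [p = 1]. *)
Lemma convolution_le f k (p x : R) : 1 <= p -> (forall t, 0 <= k t) ->
  mu.-integrable setT (EFin \o f) -> measurable_fun [set: mR] k ->
  mu.-integrable setT (EFin \o (fun y => `|f y| * k (x - y) `^ p)) ->
  `|convolution f k x| `^ p <=
  (\int[mu]_y `|f y| + 1) `^ p * (\int[mu]_y (`|f y| * k (x - y) `^ p) + 1).
Proof.
move=> p1 k0 fi mk fki; set A := \int[mu]_y `|f y|; set J := Rintegral _ _ _.
have p0 : 0 < p := lt_le_trans ltr01 p1.
have A0 : 0 <= A by apply: Rintegral_ge0.
have J0 : 0 <= J by apply: Rintegral_ge0 => y _; rewrite mulr_ge0// powR_ge0.
pose m := (J + 1) `^ p^-1.
have J1 : 0 < J + 1 by rewrite ltr_wpDl.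
have m0 : 0 < m by rewrite powR_gt0.
have mp : m `^ p = J + 1 by rewrite -powRrM mulVf ?gt_eqF// powRr1// ltW.
pose c := m `^ (1 - p).
have c0 : 0 <= c := powR_ge0 _ _.
(* If [t > m], then [t^(p - 1) >= m^(p - 1)], so that [t <= m^(1 - p) t^p]. *)
have tangent (t : R) : 0 <= t -> t <= m + c * t `^ p.
  move=> t0; have [tm|mt] := leP t m; first by rewrite ler_wpDr// mulr_ge0// powR_ge0.
  rewrite ler_wpDl//; first exact: ltW.
  rewrite -(mulr_powRB1 t0 p0) mulrCA ler_peMr// /c -opprB powRN.
  rewrite mulrC ler_pdivlMr ?powR_gt0// mul1r.
  by rewrite ge0_ler_powR// ?subr_ge0// ?nnegrE// ltW.
have mf : measurable_fun [set: mR] f by apply/measurable_EFinP; exact: measurable_int fi.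
have mkx : measurable_fun [set: mR] (fun y => k (x - y)).
  by apply: (measurableT_comp mk); exact: measurable_funB.
pose B y := m * `|f y| + c * (`|f y| * k (x - y) `^ p).
have i1 : mu.-integrable setT (EFin \o (fun y => m * `|f y|)).
  exact: (integrableZl measurableT m (integrable_norm fi)).
have i2 : mu.-integrable setT (EFin \o (fun y => c * (`|f y| * k (x - y) `^ p))).
  exact: (integrableZl measurableT c fki).
have iB : mu.-integrable setT (EFin \o B) by exact: (integrableD measurableT i1 i2).
have fkB y : `|f y * k (x - y)| <= B y.
  rewrite normrM (ger0_norm (k0 _)) /B mulrCA (mulrC m) -mulrDr ler_wpM2l//.
  exact: tangent.
have ifk : mu.-integrable setT (EFin \o (fun y => f y * k (x - y))).
  apply: (le_integrable measurableT _ _ iB).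
    by apply/measurable_EFinP; exact: measurable_funM.
  by move=> y _ /=; rewrite lee_fin (le_trans (fkB y))// ler_norm.
have le1 : `|convolution f k x| <= m * A + c * J.
  apply: (le_trans (le_normr_Rintegral measurableT ifk)).
  apply: (le_trans (le_Rintegral measurableT (integrable_norm ifk) iB (fun y _ => fkB y))).
  by rewrite /B RintegralD// !RintegralZl//; exact: integrable_norm.
(* Here [c * J <= c * (J + 1) = m], by the choice [m^p = J + 1]; the added 1 keeps [m] positive when
   [J = 0]. *)
have le2 : m * A + c * J <= (A + 1) * m.
  rewrite mulrDl mul1r mulrC lerD2l.
  have -> : m = c * (J + 1) by rewrite -mp /c -powRD ?subrK ?powRr1// ?ltW// oner_eq0.
  by rewrite ler_wpM2l// lerDl.
apply: (@le_trans _ _ (((A + 1) * m) `^ p)).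
  rewrite ge0_ler_powR// ?nnegrE//; first exact: ltW.
  - by rewrite mulr_ge0 ?addr_ge0// ltW.
  - exact: le_trans le2.
by rewrite powRM ?mp ?addr_ge0// ltW.
Qed.

(** Integrates [convolution_le] over ]a, b[. Its right-hand side is affine in the convolution of
    [|f|] with [k^p], which Fubini makes integrable and its integrand integrable for almost every
    [x], so the comparison is made almost everywhere. *)
Lemma Lp_on_convolution (a b p : R) f k : 1 <= p -> (forall t, 0 <= k t) ->
  mu.-integrable setT (EFin \o f) -> measurable_fun [set: mR] k ->
  mu.-integrable setT (EFin \o (fun t => k t `^ p)) ->
  Lp_on `]a, b[ p (convolution f k).
Proof.
move=> p1 k0 fi mk kpi.
have mconv : measurable_fun [set: mR] (convolution f k).
  apply: (measurable_Rintegral (fun z => f z.2 * k (z.1 - z.2))).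
  apply: measurable_funM; last exact: measurable_convolution_kernel.
  apply: measurableT_comp; last exact: measurable_snd.
  by apply/measurable_EFinP; exact: measurable_int fi.
have mab : measurable (`]a, b[%classic : set mR) by exact: measurable_itv.
have nfi : mu.-integrable setT (EFin \o (fun y => `|f y|)) by exact: integrable_norm.
have iK := integrable_convolution_kernel _ _ nfi kpi.
have [iJ _] := Rintegral_fubini_F _ iK.
rewrite /Lp_on /=; apply/LfunP => //; split.
  by apply/(measurable_restrictT _ mab); exact: measurable_funTS mconv.
pose J x := \int[mu]_y (`|f y| * k (x - y) `^ p).
pose C := (\int[mu]_y `|f y| + 1) `^ p.
have -> : (\int[mu]_x (`|(convolution f k \_ `]a, b[) x| `^ p)%:E =
           \int[mu]_(x in `]a, b[) (`|convolution f k x| `^ p)%:E)%E.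
  rewrite [RHS]integral_mkcond; apply: eq_integral => x _; rewrite !patchE.
  by case: ifP => // _; rewrite normr0 powR0// gt_eqF// (lt_le_trans ltr01).
have iJ1 : mu.-integrable `]a, b[ (EFin \o (fun x => C * (J x + 1))).
  have i1 : mu.-integrable `]a, b[ (EFin \o cst (1 : R)).
    apply: measurable_bounded_integrable => //; last exact: bounded_cst.
    by rewrite /= lebesgue_measure_itv/=; case: ifP => _; rewrite ltry.
  have iJab : mu.-integrable `]a, b[ (EFin \o J) by exact: (integrableS measurableT mab).
  exact: (integrableZl mab C (integrableD mab iJab i1)).
apply: (@le_lt_trans _ _ (\int[mu]_(x in `]a, b[) (C * (J x + 1))%:E)%E); last first.
  apply: (@integrable_lty _ _ _ mu _ mab) iJ1.
apply: ae_ge0_le_integral => //.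
- apply/measurable_EFinP; apply: (measurableT_comp (measurable_powR p)).
  by apply: measurableT_comp => //; exact: measurable_funTS.
- move=> x _; rewrite lee_fin mulr_ge0 ?powR_ge0// addr_ge0// Rintegral_ge0// => y _.
  by rewrite mulr_ge0// powR_ge0.
- exact: measurable_int iJ1.
have := ae_integrable1 iK; apply: filterS => x /= ix _.
by rewrite lee_fin; exact: convolution_le.
Qed.

End Lp.

(** * The du Bois-Reymond lemma *)

Section du_bois_reymond.
Context {R : realType}.
Notation mu := (@lebesgue_measure R).
Let mR := measurableTypeR R.
Implicit Types (a b c d s x y : R) (f g : R -> R).

Lemma smooth_lin (k l : R) f g : smooth f -> smooth g ->
  smooth (fun x => k * f x + l * g x).
Proof.
move=> sf sg.
pose F := [set h | exists f g : R -> R, [/\ smooth f, smooth g & h = (fun x => k * f x + l * g x)]].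
apply: (smooth_coind F); last by exists f, g.
move=> _ [f1 [g1 [sf1 sg1 ->]]].
have df x := smooth_is_derive _ x sf1; have dg x := smooth_is_derive _ x sg1.
have dh x : is_derive x 1 (fun x => k * f1 x + l * g1 x)
    (k * f1^`()%classic x + l * g1^`()%classic x).
  by apply: is_derive_eq; rewrite /GRing.scale/=; ring.
split; first by move=> x; have [] := dh x.
exists f1^`()%classic, g1^`()%classic; split; [exact: smooth_derive1..|].
by apply/funext => x; rewrite derive1E; have [_ ->] := dh x.
Qed.

Lemma smooth_test_function a b c d f : smooth f -> a < c -> d < b ->
  (forall x, ~~ (c <= x <= d) -> f x = 0) -> test_function `]a, b[ f.
Proof.
move=> sf ac db f0.
have supp : closure [set x | f x != 0] `<=` `[c, d].
  rewrite (closure_id `[c, d]).1; last exact: itv_closed.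
  apply: closure_subset => x /= fx; rewrite in_itv/=; apply: contraNT fx => xcd.
  by rewrite f0.
split => //.
- apply: (subclosed_compact _ (@segment_compact _ c d) supp).
  exact: closed_closure.
- apply: (subset_trans supp) => x; rewrite /= !in_itv/= => /andP[cx xd].
  by rewrite (lt_le_trans ac cx) (le_lt_trans xd db).
Qed.

(** For [c < d] the quadratic is positive exactly on ]c, d[. The parameter [s] is sent to 0, where
    the bump fills up to the indicator of ]c, d[. *)
Definition itv_bump (s c d : R) : R -> R :=
  bump s (('X - c%:P) * (d%:P - 'X)) 1 0.

Lemma itv_bumpE s c d x : c < d -> itv_bump s c d x =
  if c < x < d then expR (- (s / ((x - c) * (d - x)))) else 0.
Proof.
move=> cd; rewrite /itv_bump /bump hornerC hornerM hornerXsubC hornerD hornerC hornerN hornerX.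
rewrite expr0 divr1 mul1r.
congr (if _ then _ else _).
have [cx|xc] := ltP c x; have [xd|dx] := ltP x d => /=.
- by rewrite mulr_gt0// subr_gt0.
- by rewrite pmulr_rgt0 ?subr_gt0// ltNge dx.
- by rewrite pmulr_lgt0 ?subr_gt0// ltNge xc.
- by apply/negbTE; rewrite -leNgt; nra.
Qed.

Lemma itv_bump_outside s c d x : c < d -> ~~ (c <= x <= d) -> itv_bump s c d x = 0.
Proof.
move=> cd; rewrite itv_bumpE//; apply: contraNeq; case: ifP => [/andP[cx xd] _|_].
  by rewrite !ltW.
by rewrite eqxx.
Qed.

Lemma itv_bump_norm_le s c d x : c < d -> 0 < s -> `|itv_bump s c d x| <= \1_(`]c, d[) x.
Proof.
move=> cd s0; rewrite itv_bumpE// indicE mem_setE in_itv/=.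
case: ifP => [/andP[cx xd]|_]; last by rewrite normr0.
rewrite gtr0_norm ?expR_gt0// -[leRHS]expR0 ler_expR oppr_le0 divr_ge0 ?ltW//.
by rewrite mulr_gt0// subr_gt0.
Qed.

Lemma cvg_integral_itv_bump f c d : mu.-integrable setT (EFin \o f) -> c < d ->
  \int[mu]_x (f x * itv_bump n.+1%:R^-1 c d x) @[n --> \oo] -->
  \int[mu]_(x in `]c, d[) f x.
Proof.
move=> fi cd; have mf : measurable_fun [set: mR] f.
  by apply/measurable_EFinP; exact: measurable_int fi.
have mg n : measurable_fun [set: mR] (itv_bump n.+1%:R^-1 c d).
  by apply: smooth_measurable; apply: smooth_bump; rewrite invr_gt0.
pose f_ n x := (f x * itv_bump n.+1%:R^-1 c d x)%:E.
have limR x : f x * itv_bump n.+1%:R^-1 c d x @[n --> \oo] --> (f \_ `]c, d[) x.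
  rewrite patchE mem_setE in_itv/=.
  under eq_fun do rewrite itv_bumpE//.
  case: ifP => [/andP[cx xd]|_]; last by under eq_fun do rewrite mulr0; exact: cvg_cst.
  suff : f x * expR (- (n.+1%:R^-1 / ((x - c) * (d - x)))) @[n --> \oo] -->
      f x * expR (- (0 / ((x - c) * (d - x)))) by rewrite mul0r oppr0 expR0 mulr1.
  apply: cvgM; first exact: cvg_cst.
  apply: continuous_cvg; first exact: continuous_expR.
  apply: cvgN; apply: cvgM; last exact: cvg_cst.
  exact: cvg_harmonic.
have lim x : f_ n x @[n --> \oo] --> ((f \_ `]c, d[) x)%:E.
  by apply/fine_cvgP; split; [exact: nearW|exact: limR].
have [] := @dominated_convergence _ _ _ mu setT measurableT f_
  (fun x => ((f \_ `]c, d[) x)%:E) (fun x => `|f x|%:E).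
- by move=> n; apply/measurable_EFinP; exact: measurable_funM.
- apply/measurable_EFinP; apply/(measurable_restrictT _ _).1 => //.
  exact: measurable_funTS.
- by apply: aeW => x _; exact: lim.
- exact: integrable_norm.
- apply: aeW => x n _; rewrite lee_fin normrM ler_piMr//.
  have n0 : 0 < n.+1%:R^-1 :> R by rewrite invr_gt0.
  by apply: (le_trans (itv_bump_norm_le _ _ _ x cd n0)); rewrite indicE; case: (_ \in _).
move=> ifcd _ cvf; rewrite Rintegral_mkcond.
apply: fine_cvg; rewrite fineK; first exact: cvf.
exact: integrable_fin_num ifcd.
Qed.

End du_bois_reymond.

Section weak_derivative.
Context {R : realType}.
Notation mu := (@lebesgue_measure R).
Let mR := measurableTypeR R.
Implicit Types (a b c d s x y : R) (f g u v : R -> R).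

(** By Lebesgue differentiation [f] is almost everywhere the derivative of its indefinite integral,
    which is constant on ]a, b[. *)
Lemma ae_eq0_itv a b f : mu.-integrable setT (EFin \o f) ->
  (forall c d, a < c -> c < d -> d < b -> \int[mu]_(x in `]c, d[) f x = 0) ->
  {ae mu, forall x : mR, a < x < b -> f x = 0}.
Proof.
move=> fi f0; pose F (x : R) := \int[mu]_(t in `]a, x]) f t.
have fiS (A : set mR) : measurable A -> mu.-integrable A (EFin \o f).
  by move=> mA; exact: (integrableS measurableT mA).
have lf : locally_integrable setT f by apply: open_integrable_locally => //; exact: openT.
have := FTC1 (a := BRight a) (fun y => fiS _ (measurable_itv _)) lf.
apply: filterS; first exact: (ae_filter_ringOfSetsType mu).
move=> x h /andP[ax xb].
have ax' : (BRight a < BRight x)%O by rewrite bnd_simp.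
have [_ <-] := h ax'.
(* Near [x], [F] is compared with its value at the midpoint of [a] and [x], because [f0] covers only
   intervals that stay away from [a]. *)
rewrite derive1E -(derive_cst (F ((a + x) / 2)) x (1 : R)).
apply: near_eq_derive => //; near=> y.
have ac : a < (a + x) / 2 by rewrite midf_lt.
have cy : (a + x) / 2 < y by near: y; apply: lt_nbhsr; rewrite midf_lt.
have yb : y < b by near: y; exact: lt_nbhsl.
apply/eqP; rewrite -subr_eq0; apply/eqP.
rewrite /F Rintegral_itvB ?bnd_simp ?ltW//; last exact: fiS.
rewrite -Rintegral_itv_bndo_bndc; last exact: fiS.
exact: f0.
Unshelve. all: end_near. Qed.

(** Written with a kernel on the whole line, so that [kernel_swap] applies; for [v] extended by zero
    it is the integral from [a] to [x]. *)
Definition primitive v (x : R) : R := \int[mu]_y (v y * (y < x)%R%:R).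

Lemma measurable_lt_kernel :
  measurable_fun [set: mR * mR] (fun z => (z.2 < z.1)%R%:R : R).
Proof.
have -> : (fun z : mR * mR => (z.2 < z.1)%R%:R : R) =
    (fun z => if z.2 < z.1 then 1 else 0).
  by apply/funext => z; case: ifP.
apply: measurable_fun_ifT => //.
by apply: measurable_fun_ltr; [exact: measurable_snd|exact: measurable_fst].
Qed.

Lemma primitive_swap v g : mu.-integrable setT (EFin \o v) ->
  mu.-integrable setT (EFin \o g) ->
  mu.-integrable setT (EFin \o (fun x => g x * primitive v x)) /\
  \int[mu]_x (g x * primitive v x) =
  \int[mu]_y (v y * \int[mu]_x (g x * (y < x)%R%:R)).
Proof.
move=> vi gi.
have mg : measurable_fun [set: mR] g by apply/measurable_EFinP; exact: measurable_int gi.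
apply: (kernel_swap v g (fun z => (z.2 < z.1)%R%:R) (fine (\int[mu]_x `|g x|%:E)%E)) => //.
  exact: measurable_lt_kernel.
move=> y /=; rewrite fineK; last first.
  by move/integrableP : gi => [_]; rewrite ge0_fin_numE// integral_ge0.
apply: ge0_le_integral => //.
- apply/measurable_EFinP; apply: measurableT_comp => //; apply: measurable_funM => //.
  exact: (measurableT_comp measurable_lt_kernel (measurable_pair2 y)).
- by apply/measurable_EFinP; exact: measurableT_comp.
- by move=> x _; rewrite lee_fin normrM ler_piMr//; case: (_ < _); rewrite ?normr1 ?normr0.
Qed.

(* [g] has zero mean, so its primitive is again a test function. *)
Lemma integral_primitive a b c d g u v : a < c -> c < d -> d < b -> smooth g ->
  (forall x, ~~ (c <= x <= d) -> g x = 0) -> \int[mu]_x g x = 0 ->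
  mu.-integrable setT (EFin \o g) -> mu.-integrable setT (EFin \o v) ->
  (forall phi, test_function `]a, b[ phi ->
    \int[mu]_x (u x * phi^`()%classic x) = - \int[mu]_x (v x * phi x)) ->
  \int[mu]_x (u x * g x) = \int[mu]_x (g x * primitive v x).
Proof.
move=> ac cd db sg g0 Ig gi vi weak.
pose phi (y : R) := \int[mu]_(x in `]-oo, y]) g x.
have giS (A : set mR) : measurable A -> mu.-integrable A (EFin \o g).
  by move=> mA; exact: (integrableS measurableT mA).
have dphi x : is_derive x 1 phi (g x).
  have x1 : x < x + 1 by rewrite ltrDl.
  have [d1 dE] := @continuous_FTC1 _ g -oo%O x (x + 1) x1
    (giS _ (measurable_itv _)) (ltNyr x) (smooth_continuous _ sg x).
  by apply: DeriveDef => //; rewrite -derive1E.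
have phiE : phi^`()%classic = g.
  by apply/funext => x; rewrite derive1E; have [_ ->] := dphi x.
(* The zero mean of [g] makes its integral to the right of [y] the opposite of the one to the left.
   It also makes [phi] vanish beyond [d]. *)
have phiC y : \int[mu]_x (g x * (y < x)%R%:R) = - phi y.
  have -> : \int[mu]_x (g x * (y < x)%R%:R) = \int[mu]_(x in `]y, +oo[) g x.
    rewrite [RHS]Rintegral_mkcond; apply: eq_Rintegral => x _.
    rewrite patchE mem_setE in_itv/= andbT.
    by case: ifP => _; rewrite ?mulr1 ?mulr0.
  have UE : (`]y, +oo[ `|` `]-oo, y])%classic = [set: R].
    by rewrite setUC -itv_bndbnd_setU ?bnd_simp// set_itvE.
  apply/eqP; rewrite -addr_eq0 -Ig /phi -Rintegral_setU//.
  - by rewrite UE.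
  - by rewrite UE.
  - apply/disj_setPS => x /= []; rewrite !in_itv/= andbT => yx.
    by rewrite leNgt yx.
have phi0 x : ~~ (c <= x <= d) -> phi x = 0.
  move=> xcd; have [xc|cx] := ltP x c.
    rewrite /phi; under eq_Rintegral.
      move=> t; rewrite inE /= in_itv/= => tx.
      rewrite g0; last by rewrite negb_and -ltNge (le_lt_trans tx xc).
      over.
    by rewrite Rintegral_cst// mul0r.
  have dx : d < x by move: xcd; rewrite cx /= -ltNge.
  apply/eqP; rewrite -oppr_eq0 -phiC; apply/eqP.
  under eq_Rintegral.
    move=> t _; rewrite (_ : _ * _ = 0); last first.
      have [xt|_] := ltP x t; last by rewrite mulr0.
      by rewrite g0 ?mul0r// negb_and orbC -ltNge (lt_trans dx xt).
    over.
  by rewrite Rintegral_cst// mul0r.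
have sphi : smooth phi by exact: (smooth_primitive _ _ dphi sg).
have [_ ->] := primitive_swap _ _ vi gi.
have := weak _ (smooth_test_function _ _ _ _ _ sphi ac db phi0).
have [M _ phiM] := bounded_eq0_outside _ _ _ (ltW cd) (smooth_continuous _ sphi) phi0.
rewrite phiE => ->; under [RHS]eq_Rintegral do rewrite phiC mulrN -mulN1r.
rewrite RintegralZl ?mulN1r//.
under eq_fun do rewrite mulrC.
exact: (integrable_bounded_mul _ _ _ vi (smooth_measurable _ sphi) phiM).
Qed.

(** [u - primitive v] annihilates every smooth compactly supported [g] of zero mean. An arbitrary
    bump is brought to zero mean by subtracting a multiple of one fixed bump [g0]; the price is the
    constant [C]. *)
Lemma du_bois_reymond a b u v : a < b ->
  mu.-integrable setT (EFin \o u) -> mu.-integrable setT (EFin \o v) ->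
  (forall phi, test_function `]a, b[ phi ->
    \int[mu]_x (u x * phi^`()%classic x) = - \int[mu]_x (v x * phi x)) ->
  exists C, {ae mu, forall x : mR, a < x < b -> u x = C + primitive v x}.
Proof.
move=> ab ui vi weak; pose ind : R -> R := \1_(`]a, b[%classic : set R).
have indi : mu.-integrable setT (EFin \o ind) by exact: (integrable_indic_itv a b false true).
have [indVi _] := primitive_swap _ _ vi indi.
(* The primitive need not be integrable on the line; the factor [ind] repairs this and is invisible
   to functions supported in ]a, b[. *)
pose w x := u x - ind x * primitive v x.
have wi : mu.-integrable setT (EFin \o w) by exact: (integrableB measurableT ui indVi).
pose G c d (n : nat) := itv_bump n.+1%:R^-1 c d.
have sG c d n : smooth (G c d n) by apply: smooth_bump; rewrite invr_gt0.
have G0 c d n x : c < d -> ~~ (c <= x <= d) -> G c d n x = 0.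
  by move=> cd; exact: itv_bump_outside.
have indE c d g x : a < c -> d < b -> (~~ (c <= x <= d) -> g x = 0) -> ind x * g x = g x.
  move=> ac db g0; have [xcd|/g0 ->] := boolP (c <= x <= d); last by rewrite mulr0.
  move: xcd => /andP[cx xd].
  by rewrite /ind indicE mem_setE in_itv/= (lt_le_trans ac cx) (le_lt_trans xd db) mul1r.
have gi c d g : c < d -> smooth g -> (forall x, ~~ (c <= x <= d) -> g x = 0) ->
    forall f, mu.-integrable setT (EFin \o f) ->
    mu.-integrable setT (EFin \o (fun x => f x * g x)).
  move=> cd sg g0 f fi.
  have [M _ gM] := bounded_eq0_outside _ _ _ (ltW cd) (smooth_continuous _ sg) g0.
  under eq_fun do rewrite mulrC.
  exact: (integrable_bounded_mul _ _ _ fi (smooth_measurable _ sg) gM).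
have wg0 c d g : a < c -> c < d -> d < b -> smooth g ->
    (forall x, ~~ (c <= x <= d) -> g x = 0) -> \int[mu]_x (ind x * g x) = 0 ->
    \int[mu]_x (w x * g x) = 0.
  move=> ac cd db sg g0 Ig.
  have igi : mu.-integrable setT (EFin \o g).
    have := gi _ _ _ cd sg g0 _ indi; apply: eq_integrable => // x _ /=.
    by rewrite (indE c d)//; exact: g0.
  have Ig0 : \int[mu]_x g x = 0.
    by rewrite -Ig; apply: eq_Rintegral => x _; rewrite (indE c d)//; exact: g0.
  have := integral_primitive _ _ _ _ _ _ _ ac cd db sg g0 Ig0 igi vi weak.
  have [gVi _] := primitive_swap _ _ vi igi.
  move=> /eqP; rewrite -subr_eq0 -RintegralB//; last exact: (gi c d).
  move=> /eqP <-; apply: eq_Rintegral => x _.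
  rewrite /w mulrBl; congr (_ - _).
  by rewrite mulrAC (indE c d)//; exact: g0.
have Nlim c d : a < c -> c < d -> d < b ->
    \int[mu]_x (ind x * G c d n x) @[n --> \oo] --> d - c.
  move=> ac cd db.
  have -> : d - c = \int[mu]_(x in `]c, d[) ind x.
    under eq_Rintegral.
      move=> x; rewrite inE/= in_itv/= => /andP[cx xd].
      rewrite /ind indicE mem_setE in_itv/= (lt_trans ac cx) (lt_trans xd db).
      over.
    by rewrite Rintegral_cst// /= lebesgue_measure_itv/= lte_fin cd mul1r.
  exact: cvg_integral_itv_bump.
pose c0 := (a + (a + b) / 2) / 2; pose d0 := (a + b) / 2.
have ad0 : a < d0 by rewrite midf_lt.
have ac0 : a < c0 by rewrite midf_lt.
have cd0 : c0 < d0 by rewrite midf_lt.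
have db0 : d0 < b by rewrite midf_lt.
have [n0 N0] : exists n0, \int[mu]_x (ind x * G c0 d0 n0 x) != 0.
  have /cvgr_gt /(_ 0) := Nlim _ _ ac0 cd0 db0.
  rewrite subr_gt0 => /(_ cd0)[n _ /(_ n (leqnn _)) /= h].
  by exists n; rewrite gt_eqF.
set g0 := G c0 d0 n0 in N0; set N := Rintegral _ _ _ in N0.
(* The only possible value of the constant, found by testing [w = C] against [g0]. *)
pose C := (\int[mu]_x (w x * g0 x)) / N.
pose w' x := w x - C * ind x.
have w'i : mu.-integrable setT (EFin \o w').
  exact: (integrableB measurableT wi (integrableZl measurableT C indi)).
have w'G c d n : a < c -> c < d -> d < b -> \int[mu]_x (w' x * G c d n x) = 0.
  (* This [k] gives [g] zero mean, and ]c1, d1[ is wide enough to contain the supports of both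
     bumps. *)
  move=> ac cd db; pose k := (\int[mu]_x (ind x * G c d n x)) / N.
  pose g x := 1 * G c d n x + - k * g0 x.
  pose c1 := Num.min c c0; pose d1 := Num.max d d0.
  have cc1 : c1 <= c by rewrite ge_min lexx.
  have c0c1 : c1 <= c0 by rewrite ge_min lexx orbT.
  have dd1 : d <= d1 by rewrite le_max lexx.
  have d0d1 : d0 <= d1 by rewrite le_max lexx orbT.
  have ac1 : a < c1 by rewrite lt_min ac.
  have db1 : d1 < b by rewrite gt_max db.
  have cd1 : c1 < d1 by rewrite (le_lt_trans cc1)// (lt_le_trans cd).
  have Gi f : mu.-integrable setT (EFin \o f) ->
      mu.-integrable setT (EFin \o (fun x => f x * G c d n x)).
    by apply: (gi c d) => // x; exact: G0.
  have g0i f : mu.-integrable setT (EFin \o f) ->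
      mu.-integrable setT (EFin \o (fun x => f x * g0 x)).
    apply: (gi c0 d0) => // [|x]; [exact: sG|exact: G0].
  have splitg f : mu.-integrable setT (EFin \o f) ->
      \int[mu]_x (f x * g x) = \int[mu]_x (f x * G c d n x) - k * \int[mu]_x (f x * g0 x).
    move=> fi; rewrite -RintegralZl//; last exact: g0i.
    rewrite -RintegralB//; last 2 first.
    - exact: Gi.
    - exact: (integrableZl measurableT k (g0i _ fi)).
    by apply: eq_Rintegral => x _; rewrite /g; ring.
  have := wg0 c1 d1 g ac1 cd1 db1 (smooth_lin _ _ _ _ (sG _ _ _) (sG _ _ _)).
  rewrite !splitg// /k divfK// subrr => wg.
  have -> : \int[mu]_x (w' x * G c d n x) =
      \int[mu]_x (w x * G c d n x) - C * \int[mu]_x (ind x * G c d n x).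
    rewrite -RintegralZl//; last exact: Gi.
    rewrite -RintegralB//; last 2 first.
    - exact: Gi.
    - exact: (integrableZl measurableT C (Gi _ indi)).
    by apply: eq_Rintegral => x _; rewrite /w'; ring.
  have swap (p q r : R) : p / q * r = r / q * p by rewrite mulrAC (mulrC p) mulrAC.
  rewrite /C swap; apply: wg => // x; rewrite negb_and -!ltNge => xcd; rewrite /g.
  have xcd' : ~~ (c <= x <= d).
    rewrite negb_and -!ltNge; move: xcd => /orP[xc|dx]; apply/orP.
      by left; exact: lt_le_trans cc1.
    by right; exact: le_lt_trans dx.
  have xcd0 : ~~ (c0 <= x <= d0).
    rewrite negb_and -!ltNge; move: xcd => /orP[xc|dx]; apply/orP.
      by left; exact: lt_le_trans c0c1.
    by right; exact: le_lt_trans dx.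
  by rewrite /g0 !G0// !mulr0 addr0.
exists C; have := ae_eq0_itv a b w' w'i.
have w'0 c d : a < c -> c < d -> d < b -> \int[mu]_(x in `]c, d[) w' x = 0.
  move=> ac cd db; have := cvg_integral_itv_bump _ _ _ w'i cd.
  under eq_fun do rewrite w'G//.
  move=> h; apply/esym; move: h; apply: (@cvg_unique _ (@Rhausdorff R)).
  exact: cvg_cst.
move=> /(_ w'0); apply: filterS => x w'x xab; have := w'x xab.
rewrite /w' /w /ind indicE mem_setE in_itv/= xab mulr1 mul1r => /eqP.
by rewrite subr_eq0 => /eqP <-; rewrite subrK.
Qed.

End weak_derivative.

(** * Left fractional derivatives *)

Section left_case.
Context {R : realType}.
Notation mu := (@lebesgue_measure R).
Let mR := measurableTypeR R.
Implicit Types (a b c x y L : R) (f g k u v phi : R -> R).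

Lemma test_function_eq0 a b phi x : test_function `]a, b[ phi ->
  ~~ (a < x < b) -> phi x = 0.
Proof.
move=> [_ _ supp]; apply: contraNeq => phix.
have : `]a, b[%classic x by apply: supp; exact: subset_closure.
by rewrite /= in_itv.
Qed.

Lemma test_function_eq0_cc a b phi x : test_function `]a, b[ phi ->
  ~~ (a <= x <= b) -> phi x = 0.
Proof.
move=> tphi xab; apply: test_function_eq0 tphi _; apply: contra xab => /andP[ax xb].
by rewrite !ltW.
Qed.

Lemma Rintegral_derive1 f g a b : a < b -> (forall x : R, is_derive x 1 f (g x)) ->
  continuous g -> \int[mu]_(x in `]a, b[) g x = f b - f a.
Proof.
move=> ab df cg.
have cgab : {within `[a, b], continuous g} by exact: continuous_subspaceT.
have gi : mu.-integrable `[a, b] (EFin \o g).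
  by apply: continuous_compact_integrable => //; exact: segment_compact.
have cf : {within `[a, b], continuous f}.
  by apply: derivable_within_continuous => x _; have [] := df x.
rewrite Rintegral_itv_bndo_bndc; last by apply: integrableS gi => //; exact: subset_itv_oo_cc.
rewrite Rintegral_itv_obnd_cbnd; last by apply: integrableS gi => //; exact: subset_itv_oc_cc.
rewrite /Rintegral (@continuous_FTC2 _ _ f)//.
- have [_ fa fb] := (continuous_within_itvP _ ab).1 cf.
  by split => // x _; have [] := df x.
- by move=> x _; rewrite derive1E; have [_ ->] := df x.
Qed.

Lemma correlation_shift f phi y : measurable_fun [set: mR] f -> measurable_fun [set: mR] phi ->
  \int[mu]_x (phi x * f (x - y)) = correlation f phi y.
Proof.
move=> mf mphi; pose F x := (phi x * f (x - y))%:E.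
have mF : measurable_fun [set: mR] F.
  apply/measurable_EFinP; apply: measurable_funM => //.
  by apply: (measurableT_comp mf); exact: measurable_shift.
have := integral_preserving _ (measurable_shift y) (lebesgue_measure_shift y) _ mF.
rewrite /Rintegral => <-; congr fine; apply: eq_integral => x _.
by rewrite /F addrK addrC.
Qed.

(** The upper limit [b] is enforced by the vanishing of [phi], the lower limit [x] by that of the
    kernel. For [a <= x] and [y < b] the difference [y - x] stays below the cutoff [b - a]. *)
Lemma frac_int_rightE a b (s : R) phi x : a < b -> measurable_fun [set: mR] phi ->
  (forall y, b <= y -> phi y = 0) -> a <= x ->
  frac_int_right b (1 - s) phi x =
  (Gamma (1 - s))^-1 * correlation (power_kernel s (b - a)) phi x.
Proof.
move=> ab mphi phi0 ax; rewrite /frac_int_right; congr (_ * _).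
rewrite -correlation_shift//; last exact: measurable_power_kernel.
rewrite Rintegral_mkcond; apply: eq_Rintegral => y _.
rewrite patchE mem_setE in_itv/= /power_kernel subr_gt0.
have [by_|yb] := leP b y; first by rewrite andbF phi0// mul0r.
have [xy|yx] /= := ltP x y; last by rewrite mulr0.
have -> : y - x < b - a by lra.
by rewrite powRN; congr (_ / (_ `^ _)); ring.
Qed.

(** The boundary term at [b] is 0: [k] lives on [t > 0], where [phi (b + t)] vanishes. *)
Lemma correlation_derive1_ab a b k phi y : test_function `]a, b[ phi -> a < b ->
  mu.-integrable setT (EFin \o k) -> (forall t, t <= 0 -> k t = 0) -> y < b ->
  \int[mu]_(x in `]y, b[) correlation k phi^`()%classic x = - correlation k phi y.
Proof.
move=> tphi ab ki k0 yb; have [sphi _ _] := tphi.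
have phi0 x : ~~ (a <= x <= b) -> phi x = 0 by exact: test_function_eq0_cc.
have dpsi x := is_derive_correlation _ _ _ _ x (ltW ab) sphi phi0 ki.
rewrite (Rintegral_derive1 _ _ _ _ yb dpsi).
- rewrite [X in X - _](_ : _ = 0) ?sub0r// /correlation.
  under eq_Rintegral.
    move=> t _; rewrite (_ : _ * _ = 0); last first.
      have [/k0 ->|t0] := leP t 0; first by rewrite mulr0.
      by rewrite phi0 ?mul0r// negb_and orbC -ltNge ltrDl t0.
    over.
  by rewrite Rintegral_cst// mul0r.
- move=> x; apply/differentiable_continuous/derivable1_diffP.
  have [] // := is_derive_correlation _ _ _ _ x (ltW ab) (smooth_derive1 _ sphi)
    (derive1_eq0_outside _ _ _ phi0) ki.
Qed.

Lemma correlation_le k phi (M : R) y : mu.-integrable setT (EFin \o k) ->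
  measurable_fun [set: mR] phi -> (forall x, `|phi x| <= M) ->
  `|correlation k phi y| <= M * \int[mu]_t `|k t|.
Proof.
move=> ki mphi phiM.
have mphiy : measurable_fun [set: mR] (fun t => phi (y + t)).
  by apply: (measurableT_comp mphi); exact: measurable_funD.
have i1 := integrable_bounded_mul _ _ _ ki mphiy (fun t => phiM (y + t)).
have nki := integrable_norm ki.
apply: (le_trans (le_normr_Rintegral measurableT i1)).
rewrite -(RintegralZl M measurableT nki).
apply: (le_Rintegral measurableT (integrable_norm i1) (integrableZl measurableT M nki)).
by move=> t _; rewrite /= normrM ler_wpM2r.
Qed.

Lemma is_derive_frac_int_right a b (s : R) phi x : a < b -> s < 1 -> a < x ->
  test_function `]a, b[ phi ->
  is_derive x 1 (frac_int_right b (1 - s) phi) ((Gamma (1 - s))^-1 *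
    correlation (power_kernel s (b - a)) phi^`()%classic x).
Proof.
move=> ab s1 ax tphi; have [sphi _ _] := tphi.
set k := power_kernel _ _; set kappa := _^-1.
have ki : mu.-integrable setT (EFin \o k).
  by apply: integrable_power_kernel; rewrite ?subr_gt0.
have dpsi := is_derive_correlation _ _ _ _ x (ltW ab) sphi
  (fun x => test_function_eq0_cc _ _ _ x tphi) ki.
(* [frac_int_rightE] is available from [a] on, and [a < x] makes this a neighbourhood of [x]. *)
apply: (@near_eq_is_derive _ _ _ (fun z => kappa * correlation k phi z)) => //.
  near=> z; apply/esym/frac_int_rightE => //.
  - exact: smooth_measurable.
  - by move=> y yb; apply: (test_function_eq0 a b) => //; rewrite negb_and -!leNgt yb orbT.
  - by apply: ltW; near: z; exact: lt_nbhsr.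
Unshelve. all: end_near. Qed.

Lemma frac_deriv_rightE a b (s : R) phi x : a < b -> s < 1 -> a < x ->
  test_function `]a, b[ phi ->
  frac_deriv_right b s phi x = - ((Gamma (1 - s))^-1 *
    correlation (power_kernel s (b - a)) phi^`()%classic x).
Proof.
move=> ab s1 ax tphi; rewrite /frac_deriv_right derive1E.
by have [_ ->] := is_derive_frac_int_right _ _ _ _ _ ab s1 ax tphi.
Qed.

(* Here [f] is the weak derivative of [u], extended by zero. *)
Lemma weak_frac_deriv_left_identity a b (s C : R) u f phi : a < b -> s < 1 ->
  mu.-integrable setT (EFin \o u) -> mu.-integrable setT (EFin \o f) ->
  {ae mu, forall x : mR, a < x < b -> u x = C + primitive f x} ->
  (forall x, ~~ (a < x < b) -> f x = 0) ->
  test_function `]a, b[ phi ->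
  \int[mu]_(x in `]a, b[) ((Gamma (1 - s))^-1 *
     (C * power_kernel s (b - a) (x - a) + convolution f (power_kernel s (b - a)) x) * phi x) =
  \int[mu]_(x in `]a, b[) (u x * frac_deriv_right b s phi x).
Proof.
move=> ab s1 ui fi uE f0 tphi; have [sphi _ _] := tphi.
set kappa := _^-1; set k := power_kernel _ _.
have phi0 x : ~~ (a < x < b) -> phi x = 0 by exact: test_function_eq0.
have phi0' x : ~~ (a <= x <= b) -> phi x = 0 by exact: test_function_eq0_cc.
have mphi : measurable_fun [set: mR] phi by exact: smooth_measurable.
have L0 : 0 < b - a by rewrite subr_gt0.
have ki : mu.-integrable setT (EFin \o k) by exact: integrable_power_kernel.
have mk : measurable_fun [set: mR] k by exact: measurable_power_kernel.
have k0 t : t <= 0 -> k t = 0 by move=> t0; rewrite /k /power_kernel ltNge t0.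
have kai : mu.-integrable setT (EFin \o (fun x => k (x - a))).
  exact: (integrable_preserving _ (measurable_shift (- a)) (lebesgue_measure_shift (- a)) _ ki).
have [M M0 phiM] := bounded_eq0_outside _ _ _ (ltW ab) (smooth_continuous _ sphi) phi0'.
pose psi := correlation k phi; pose psi' := correlation k phi^`()%classic.
have psiE y : \int[mu]_x (phi x * k (x - y)) = psi y by exact: correlation_shift.
have dpsi x : is_derive x 1 psi (psi' x).
  exact: (is_derive_correlation _ _ _ _ x (ltW ab) sphi phi0' ki).
have cpsi' : continuous psi'.
  move=> x; apply/differentiable_continuous/derivable1_diffP.
  by have [] := is_derive_correlation _ _ _ _ x (ltW ab) (smooth_derive1 _ sphi)
    (derive1_eq0_outside _ _ _ phi0') ki.
have [convi convE] : mu.-integrable setT (EFin \o (fun x => phi x * convolution f k x)) /\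
    \int[mu]_x (phi x * convolution f k x) = \int[mu]_y (f y * psi y).
  have := kernel_swap f phi (fun z => k (z.1 - z.2)) (M * fine (\int[mu]_x `|k x|%:E)%E) fi mphi
    (measurable_convolution_kernel _ mk).
  case.
    (* [M] bounds [phi], and by translation invariance the integral of [|k (x - y)|] in [x] does not
       depend on [y]. *)
    move=> y /=; have kM : (\int[mu]_x `|k x|%:E)%E \is a fin_num.
      by move/integrableP : ki => [_]; rewrite ge0_fin_numE// integral_ge0.
    rewrite EFinM fineK// -(integral_convolution_kernel _ y mk) -ge0_integralZl//; last first.
      apply/measurable_EFinP; apply: measurableT_comp => //.
      by apply: (measurableT_comp mk); exact: (measurable_shift (- y)).
    apply: ge0_le_integral => //.
    - apply/measurable_EFinP; apply: measurableT_comp => //; apply: measurable_funM => //.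
      by apply: (measurableT_comp mk); exact: (measurable_shift (- y)).
    - apply/measurable_EFinP; apply: measurable_funM => //; apply: measurableT_comp => //.
      by apply: (measurableT_comp mk); exact: (measurable_shift (- y)).
    - by move=> x _; rewrite lee_fin normrM ler_wpM2r.
  move=> swapi swapE; split; first exact: swapi.
  apply: (etrans swapE); apply: eq_Rintegral => y _ /=.
  by rewrite (psiE y).
have phikai : mu.-integrable setT (EFin \o (fun x => phi x * k (x - a))).
  exact: (integrable_bounded_mul _ _ _ kai mphi phiM).
have -> : \int[mu]_(x in `]a, b[) (kappa * (C * k (x - a) + convolution f k x) * phi x) =
    kappa * (C * psi a + \int[mu]_y (f y * psi y)).
  transitivity (\int[mu]_x (kappa * (C * (phi x * k (x - a)) + phi x * convolution f k x))).
    rewrite Rintegral_mkcond; apply: eq_Rintegral => x _; rewrite patchE mem_setE in_itv/=.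
    case: ifPn => [_|/phi0 ->]; first by ring.
    by rewrite !mul0r mulr0 addr0 mulr0.
  have i1 : mu.-integrable setT (EFin \o (fun x => C * (phi x * k (x - a)))).
    exact: (integrableZl measurableT C phikai).
  have i2 : mu.-integrable setT
      (EFin \o (fun x => C * (phi x * k (x - a)) + phi x * convolution f k x)).
    exact: (integrableD measurableT i1 convi).
  by rewrite (RintegralZl kappa measurableT i2) (RintegralD measurableT i1 convi)
    (RintegralZl C measurableT phikai) (psiE a) convE.
have psi'_itv y : y < b -> \int[mu]_(x in `]y, b[) psi' x = - psi y.
  exact (correlation_derive1_ab _ _ _ _ _ tphi ab ki k0).
have fracD x : a < x -> frac_deriv_right b s phi x = - (kappa * psi' x).
  by move=> ax; exact (frac_deriv_rightE _ _ _ _ _ ab s1 ax tphi).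
have [B psiB] : exists B, forall y, `|psi y| <= B.
  by exists (M * \int[mu]_t `|k t|) => y; exact (correlation_le _ _ _ _ ki mphi phiM).
clearbody psi psi' kappa.
pose ind : R -> R := \1_(`]a, b[%classic : set R).
have indE x : ind x = if a < x < b then 1 else 0.
  by rewrite /ind indicE mem_setE in_itv/=; case: ifP.
have psi'i : mu.-integrable setT (EFin \o (fun x => ind x * psi' x)).
  have -> : EFin \o (fun x => ind x * psi' x) = (EFin \o psi') \_ `]a, b[.
    apply/funext => x; rewrite patchE mem_setE in_itv/= indE.
    by case: ifP => _; rewrite ?mul1r ?mul0r.
  have psi'ci : mu.-integrable `[a, b] (EFin \o psi').
    apply: continuous_compact_integrable; first exact: segment_compact.
    exact: continuous_subspaceT.
  have mab : measurable (`]a, b[%classic : set mR) by exact: measurable_itv.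
  apply: (integrable_mkcond _ mab).1; apply: integrableS psi'ci => //.
  exact: subset_itv_oo_cc.
have [psi'Vi psi'VE] := primitive_swap _ _ fi psi'i.
(* The endpoint [y = a] is included for the sake of the term with [C]; interior points serve the
   term with [f]. *)
have psi'I y : a <= y < b -> \int[mu]_x (ind x * psi' x * (y < x)%R%:R) = - psi y.
  move=> /andP[ay yb]; rewrite -(psi'_itv y yb).
  rewrite [RHS]Rintegral_mkcond; apply: eq_Rintegral => x _.
  rewrite patchE mem_setE in_itv/= indE.
  have [yx|xy] /= := ltP y x; last by rewrite mulr0.
  by rewrite (le_lt_trans ay yx)/= mulr1; case: ifP => _; rewrite ?mul1r ?mul0r.
have psi'Ia : \int[mu]_x (ind x * psi' x) = - psi a.
  have aab : a <= a < b by rewrite lexx ab.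
  rewrite -(psi'I a aab); apply: eq_Rintegral => x _; rewrite indE.
  by case: ifP => [/andP[-> _]|_]; rewrite ?mulr1// mul0r mul0r.
have i1 : mu.-integrable setT (EFin \o (fun x => C * (ind x * psi' x))).
  exact: (integrableZl measurableT C psi'i).
have i2 : mu.-integrable setT
    (EFin \o (fun x => C * (ind x * psi' x) + ind x * psi' x * primitive f x)).
  exact: (integrableD measurableT i1 psi'Vi).
have -> : \int[mu]_(x in `]a, b[) (u x * frac_deriv_right b s phi x) =
    \int[mu]_x (- kappa * (C * (ind x * psi' x) + ind x * psi' x * primitive f x)).
  rewrite Rintegral_mkcond; transitivity (\int[mu]_x (- kappa * (u x * (ind x * psi' x)))).
    apply: eq_Rintegral => x _; rewrite patchE mem_setE in_itv/= indE.
    case: ifP => [/andP[ax _]|_]; last by rewrite mul0r mulr0 mulr0.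
    by rewrite (fracD _ ax); ring.
  have m1 : measurable_fun [set: mR] (fun x => (- kappa * (u x * (ind x * psi' x)))%:E).
    apply/measurable_EFinP; apply: measurable_funM; first exact: measurable_cst.
    apply: measurable_funM.
      by apply/measurable_EFinP; exact: measurable_int ui.
    by apply/measurable_EFinP; exact: measurable_int psi'i.
  have m2 : measurable_fun [set: mR]
      (fun x => (- kappa * (C * (ind x * psi' x) + ind x * psi' x * primitive f x))%:E).
    apply/measurable_EFinP; apply: measurable_funM; first exact: measurable_cst.
    by apply/measurable_EFinP; exact: measurable_int i2.
  congr fine; apply: (ae_eq_integral _ _ measurableT m1 m2).
  move: uE; apply: filterS => x uxE _; rewrite indE.
  case: ifPn => [/uxE ->|_]; congr EFin; first by ring.
  by rewrite mul0r mulr0 mulr0 mul0r add0r.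
rewrite (RintegralZl (- kappa) measurableT i2) (RintegralD measurableT i1 psi'Vi).
rewrite (RintegralZl C measurableT psi'i) psi'Ia psi'VE.
have -> : \int[mu]_y (f y * \int[mu]_x (ind x * psi' x * (y < x)%R%:R)) =
    - \int[mu]_y (f y * psi y).
  have mpsi : measurable_fun [set: mR] psi.
    apply: continuous_measurable_fun => x.
    by apply/differentiable_continuous/derivable1_diffP; have [] := dpsi x.
  have fpsii : mu.-integrable setT (EFin \o (fun y => f y * psi y)).
    under eq_fun do rewrite mulrC.
    exact: (integrable_bounded_mul _ _ _ fi mpsi psiB).
  rewrite -mulN1r -(RintegralZl (- 1) measurableT fpsii); apply: eq_Rintegral => y _.
  have [yab|/f0 ->] := boolP (a < y < b); last by rewrite !mul0r mulr0.
  rewrite psi'I; first by ring.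
  by move: yab => /andP[ay yb]; rewrite ltW.
ring.
Qed.

(** * Membership in L^p and the left inclusion *)

Lemma Lp_on_combination (D : set R) (p k l : R) f g : 1 <= p ->
  Lp_on D p f -> Lp_on D p g -> Lp_on D p (fun x => k * f x + l * g x).
Proof.
move=> p1 Lf Lg; have p1' : (1%E <= p%:E)%E by rewrite lee_fin.
have [_ lin] := @Lfun_submod_closed _ _ _ mu p%:E p1'.
have lin0 h : h \in Lfun mu p%:E -> forall r : R, r *: h \in Lfun mu p%:E.
  move=> Lh r; have [L0 _] := @Lfun_submod_closed _ _ _ mu p%:E p1'.
  by rewrite -[_ *: _]addr0; exact: lin.
rewrite /Lp_on /=; have -> : (fun x => k * f x + l * g x) \_ D =
    (k *: (f \_ D) + l *: (g \_ D))%R.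
  apply/funext => x; rewrite patchE !fctE !patchE.
  by case: ifP => // _; rewrite /GRing.scale/= !mulr0 addr0.
by apply: lin => //; exact: lin0.
Qed.

Lemma Lp_on_power_kernel a b (s p : R) : a < b -> 1 <= p -> s * p < 1 ->
  Lp_on `]a, b[ p (fun x => power_kernel s (b - a) (x - a)).
Proof.
move=> ab p1 sp1; set k := power_kernel _ _.
have p0 : 0 < p := lt_le_trans ltr01 p1.
have mk : measurable_fun [set: mR] (fun x => k (x - a)).
  apply: (measurableT_comp (measurable_power_kernel _ _)); exact: (measurable_shift (- a)).
have mab : measurable (`]a, b[%classic : set mR) by exact: measurable_itv.
rewrite /Lp_on /=; apply/LfunP => //.
have mres : measurable_fun [set: mR] ((fun x => k (x - a)) \_ `]a, b[).
  by apply/(measurable_restrictT _ mab); exact: measurable_funTS mk.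
split => //.
have L0 : 0 < b - a by rewrite subr_gt0.
have := integrable_preserving _ (measurable_shift (- a)) (lebesgue_measure_shift (- a)) _
  (integrable_power_kernel _ _ L0 sp1).
move=> /integrableP[mkp]; apply: le_lt_trans.
apply: ge0_le_integral => //.
- apply/measurable_EFinP; apply: (measurableT_comp (measurable_powR p)).
  exact: measurableT_comp.
- exact: measurableT_comp.
- move=> x _ /=; rewrite lee_fin [leRHS]ger0_norm ?power_kernel_ge0// patchE.
  case: ifP => _; last by rewrite [`|_|]normr0 powR0 ?gt_eqF// power_kernel_ge0.
  by rewrite ger0_norm ?power_kernel_ge0// power_kernel_powR.
Qed.

Lemma Lp_on_locally_integrable a b (p : R) f : 1 <= p -> Lp_on `]a, b[ p f ->
  locally_integrable `]a, b[ f.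
Proof.
move=> p1 /(Lp_on_integrable _ _ _ _ p1) fi.
apply: open_integrable_locally; first exact: interval_open.
have mab : measurable (`]a, b[%classic : set mR) by exact: measurable_itv.
apply: (integrable_mkcond _ mab).2.
by rewrite -restrict_EFin in fi.
Qed.

Lemma Lp_on_1 a b (p : R) f : 1 <= p -> Lp_on `]a, b[ p f -> Lp_on `]a, b[ 1 f.
Proof.
move=> p1 /(Lp_on_integrable _ _ _ _ p1) /integrableP[/measurable_EFinP mf fi].
rewrite /Lp_on /=; apply/LfunP => //; split => //.
by under eq_integral do rewrite powRr1//.
Qed.

Lemma Rintegral_restrictM (D : set R) f g :
  \int[mu]_(x in D) (f x * g x) = \int[mu]_x ((f \_ D) x * g x).
Proof.
rewrite Rintegral_mkcond; apply: eq_Rintegral => x _.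
by rewrite !patchE; case: ifP => // _; rewrite mul0r.
Qed.

Lemma sobolev1_frac_sobolev_left a b (s p : R) : a < b -> s < 1 ->
  1 <= p -> s * p < 1 -> sobolev1 a b p `<=` frac_sobolev_left a b s p.
Proof.
move=> ab s1 p1 sp1 u [Lu [v [_ _ weak] Lv]].
have p0 : 0 < p := lt_le_trans ltr01 p1.
have L0 : 0 < b - a by rewrite subr_gt0.
set ab_ := (`]a, b[%classic : set R).
have ui := Lp_on_integrable _ _ _ _ p1 Lu; have vi := Lp_on_integrable _ _ _ _ p1 Lv.
have weak' phi : test_function `]a, b[ phi ->
    \int[mu]_x ((u \_ ab_) x * phi^`()%classic x) = - \int[mu]_x ((v \_ ab_) x * phi x).
  by move=> tphi; rewrite -!Rintegral_restrictM; exact: weak.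
have [C uE] := du_bois_reymond _ _ _ _ ab ui vi weak'.
pose k := power_kernel s (b - a).
pose G x := (Gamma (1 - s))^-1 * (C * k (x - a) + convolution (v \_ ab_) k x).
have LG : Lp_on `]a, b[ p G.
  have Lk : Lp_on `]a, b[ p (fun x => k (x - a)) by exact: Lp_on_power_kernel.
  have Lconv : Lp_on `]a, b[ p (convolution (v \_ ab_) k).
    apply: Lp_on_convolution => //.
    - by move=> t; exact: power_kernel_ge0.
    - exact: measurable_power_kernel.
    - under eq_fun do rewrite power_kernel_powR//.
      exact: integrable_power_kernel.
  have := Lp_on_combination _ _ ((Gamma (1 - s))^-1 * C) (Gamma (1 - s))^-1 _ _ p1 Lk Lconv.
  by congr (Lp_on _ _ _); apply/funext => x; rewrite /G mulrDr mulrA.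
split => //; exists G => //; split.
- exact: Lp_on_1 Lu.
- exact: Lp_on_locally_integrable LG.
- move=> phi tphi.
  have f0 x : ~~ (a < x < b) -> (v \_ ab_) x = 0.
    by move=> xab; rewrite patchE mem_setE in_itv/= (negbTE xab).
  rewrite (weak_frac_deriv_left_identity _ _ _ _ _ _ _ ab s1 ui vi uE f0 tphi).
  by apply: eq_Rintegral => x xab; rewrite patchE xab.
Qed.

End left_case.

(** * Right fractional derivatives *)

Section reflection.
Context {R : realType}.
Notation mu := (@lebesgue_measure R).
Let mR := measurableTypeR R.
Implicit Types (a b c x y : R) (f g u v phi : R -> R).

Definition reflect_fun c f x : R := f (c - x).

Lemma restrict_reflect a b f :
  reflect_fun (a + b) f \_ `]a, b[ = reflect_fun (a + b) (f \_ `]a, b[).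
Proof.
apply/funext => x; rewrite /reflect_fun !patchE !mem_setE !in_itv/=.
have -> // : (a < x < b) = (a < a + b - x < b).
by apply/idP/idP => /andP[h1 h2]; apply/andP; split; lra.
Qed.

Lemma measurable_reflect_fun c f : measurable_fun [set: mR] f ->
  measurable_fun [set: mR] (reflect_fun c f).
Proof. by move=> mf; apply: (measurableT_comp mf); exact: measurable_reflect. Qed.

Lemma Rintegral_reflect c f : measurable_fun [set: mR] f ->
  \int[mu]_x reflect_fun c f x = \int[mu]_x f x.
Proof.
move=> mf; congr fine.
exact: (integral_preserving _ (measurable_reflect c) (lebesgue_measure_reflect c) (EFin \o f)
  (measurableT_comp _ mf)).
Qed.

Lemma Rintegral_itv_reflect a b f : measurable_fun [set: mR] (f \_ `]a, b[) ->
  \int[mu]_(x in `]a, b[) reflect_fun (a + b) f x = \int[mu]_(x in `]a, b[) f x.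
Proof.
by move=> mf; rewrite Rintegral_mkcond [RHS]Rintegral_mkcond restrict_reflect Rintegral_reflect.
Qed.

Lemma is_derive_reflect c f x (l : R) : is_derive (c - x) 1 f l ->
  is_derive x 1 (reflect_fun c f) (- l).
Proof.
move=> df; have dr : is_derive x 1 (fun y : R => c - y) (- 1).
  by apply: is_derive_eq; ring.
have := @is_derive1_comp _ f (fun y => c - y) x _ _ df dr.
by rewrite mulrN1.
Qed.

Lemma derive1_reflect c phi x : smooth phi ->
  (reflect_fun c phi)^`()%classic x = - reflect_fun c phi^`()%classic x.
Proof.
move=> sphi; rewrite derive1E.
by have [_ ->] := is_derive_reflect c _ x _ (smooth_is_derive _ (c - x) sphi).
Qed.

(** The scalar [k] in the family absorbs the sign that each differentiation of [f (c - x)]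
    produces. *)
Lemma smooth_reflect c phi : smooth phi -> smooth (reflect_fun c phi).
Proof.
move=> sphi.
pose F := [set h | exists2 f : R -> R, smooth f &
  exists k : R, h = (fun x => k * reflect_fun c f x)].
apply: (smooth_coind F); last first.
  by exists phi => //; exists 1; apply/funext => x; rewrite mul1r.
move=> _ [f sf [k ->]].
have dh x : is_derive x 1 (fun x => k * reflect_fun c f x)
    (- k * reflect_fun c f^`()%classic x).
  have df := is_derive_reflect c _ x _ (smooth_is_derive _ (c - x) sf).
  by apply: is_derive_eq; rewrite /GRing.scale/= /reflect_fun; ring.
split; first by move=> x; have [] := dh x.
exists f^`()%classic; first exact: smooth_derive1.
by exists (- k); apply/funext => x; rewrite derive1E; have [_ ->] := dh x.
Qed.

Lemma test_function_reflect a b phi : test_function `]a, b[ phi ->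
  test_function `]a, b[ (reflect_fun (a + b) phi).
Proof.
move=> [sphi cK Kab]; pose r x := a + b - x.
have cr : continuous r by move=> x; apply: cvgB; [exact: cvg_cst|exact: cvg_id].
set K := closure _ in cK Kab.
(* [r] is an involution. The reflected support is closed as a preimage and compact as an image. *)
have rK : r @^-1` K = r @` K.
  apply/seteqP; split=> x /=; first by exists (r x) => //; rewrite /r subKr.
  by move=> [y Ky <-]; rewrite /r subKr.
have supp : closure [set x | reflect_fun (a + b) phi x != 0] `<=` r @^-1` K.
  rewrite (closure_id (r @^-1` K)).1; last first.
    by apply: preimage_closed => //; exact: closed_closure.
  by apply: closure_subset => x /= phix; exact: subset_closure.
split; first exact: smooth_reflect.
- apply: (subclosed_compact _ _ supp); first exact: closed_closure.
  rewrite rK; apply: continuous_compact => //; exact: continuous_subspaceT.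
- apply: (subset_trans supp) => x /= /Kab; rewrite /= !in_itv/= /r => /andP[h1 h2].
  by apply/andP; split; lra.
Qed.

Lemma Lp_on_reflect a b (p : R) f : 1 <= p -> Lp_on `]a, b[ p f ->
  Lp_on `]a, b[ p (reflect_fun (a + b) f).
Proof.
move=> p1; rewrite /Lp_on /= => /(LfunP _ _ p1)[mf fi].
apply/LfunP => //; rewrite restrict_reflect; split; first exact: measurable_reflect_fun.
have mfp : measurable_fun [set: mR] (fun x => (`|(f \_ `]a, b[) x| `^ p)%:E).
  apply/measurable_EFinP; apply: (measurableT_comp (measurable_powR p)).
  exact: measurableT_comp.
have := integral_preserving _ (measurable_reflect (a + b)) (lebesgue_measure_reflect (a + b)) _ mfp.
by rewrite /reflect_fun => ->.
Qed.

Lemma Lp_on_measurable (D : set R) (p : R) f : Lp_on D p f ->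
  measurable_fun [set: mR] (f \_ D).
Proof. by rewrite /Lp_on /= inE => /andP[/[1!inE]/= mf _]. Qed.

Lemma Rintegral_reflectM a b f g : measurable_fun [set: mR] (f \_ `]a, b[) ->
  measurable_fun [set: mR] g ->
  \int[mu]_(x in `]a, b[) (reflect_fun (a + b) f x * g x) =
  \int[mu]_(x in `]a, b[) (f x * reflect_fun (a + b) g x).
Proof.
move=> mf mg.
rewrite -[RHS]Rintegral_itv_reflect.
  by apply: eq_Rintegral => x _; rewrite /reflect_fun subKr.
have -> : (fun x => f x * reflect_fun (a + b) g x) \_ `]a, b[ =
    (fun x => (f \_ `]a, b[) x * reflect_fun (a + b) g x).
  by apply/funext => x; rewrite !patchE; case: ifP => // _; rewrite mul0r.
by apply: measurable_funM => //; exact: measurable_reflect_fun.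
Qed.

(** [fine] sends both infinities to 0, so the sign comes out even when the positive or negative part
    has infinite integral. *)
Lemma RintegralN (D : set R) f : \int[mu]_(x in D) - f x = - \int[mu]_(x in D) f x.
Proof.
rewrite /Rintegral integralE [in RHS]integralE.
have -> : (fun x => (- f x)%:E) = (\- (EFin \o f))%E by [].
rewrite funeposN funenegN -[(fun x => (f x)%:E)]/(EFin \o f).
move: (integral _ _ _) (integral _ _ _) => [p| |] [n| |] //=; rewrite ?oppr0//.
by rewrite opprB.
Qed.

Lemma sobolev1_reflect a b (p : R) u : 1 <= p -> sobolev1 a b p u ->
  sobolev1 a b p (reflect_fun (a + b) u).
Proof.
move=> p1 [Lu [v [_ _ weak] Lv]].
(* The sign is that of the chain rule; the zero term gives [v'] the shape of [Lp_on_combination]. *)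
pose v' x := - 1 * reflect_fun (a + b) v x + 0 * reflect_fun (a + b) v x.
have LNv : Lp_on `]a, b[ p v' by apply: Lp_on_combination => //; exact: Lp_on_reflect.
have Lru := Lp_on_reflect _ _ _ _ p1 Lu.
split => //; exists v' => //.
split; [exact: Lp_on_locally_integrable Lru|exact: Lp_on_locally_integrable LNv|].
move=> phi tphi; have [sphi _ _] := tphi.
have mphi : measurable_fun [set: mR] phi by exact: smooth_measurable.
have mphi' : measurable_fun [set: mR] phi^`()%classic.
  by apply: smooth_measurable; exact: smooth_derive1.
have mu_ := Lp_on_measurable _ _ _ Lu; have mv := Lp_on_measurable _ _ _ Lv.
have := weak _ (test_function_reflect _ _ _ tphi).
rewrite -(Rintegral_reflectM _ _ _ _ mv mphi) => weakE.
rewrite (Rintegral_reflectM _ _ _ _ mu_ mphi').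
rewrite -[LHS]opprK -RintegralN; congr (- _).
transitivity (\int[mu]_(x in `]a, b[) (u x * (reflect_fun (a + b) phi)^`()%classic x)).
  by apply: eq_Rintegral => x _; rewrite derive1_reflect// mulrN.
rewrite weakE -RintegralN; apply: eq_Rintegral => x _.
by rewrite /v' mul0r addr0 mulN1r mulNr.
Qed.

Lemma frac_int_left_reflect a b (s : R) phi x : measurable_fun [set: mR] phi ->
  frac_int_left a s phi x = frac_int_right b s (reflect_fun (a + b) phi) (a + b - x).
Proof.
move=> mphi; rewrite /frac_int_left /frac_int_right; congr (_ * _).
pose F y := (if a < y < x then phi y / (x - y) `^ (1 - s) else 0) : R.
have mF : measurable_fun [set: mR] F.
  have -> : F = (fun y => phi y / (x - y) `^ (1 - s)) \_ `]a, x[.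
    by apply/funext => y; rewrite patchE mem_setE in_itv.
  have max : measurable (`]a, x[%classic : set mR) by exact: measurable_itv.
  apply/(measurable_restrictT _ max); apply: measurable_funTS.
  apply: measurable_funM => //; under eq_fun do rewrite -powRN.
  apply: (measurableT_comp (measurable_powR _)); exact: (measurable_reflect x).
transitivity (\int[mu]_y F y).
  by rewrite Rintegral_mkcond; apply: eq_Rintegral => y _; rewrite patchE mem_setE in_itv.
rewrite -(Rintegral_reflect (a + b) _ mF) [RHS]Rintegral_mkcond.
apply: eq_Rintegral => y _; rewrite patchE mem_setE in_itv/= /reflect_fun /F.
have -> : (a < a + b - y < x) = (a + b - x < y < b).
  by apply/idP/idP => /andP[h1 h2]; apply/andP; split; lra.
by case: ifP => // _; congr (_ / (_ `^ _)); ring.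
Qed.

(** The sign of the chain rule is matched by the one built into [frac_deriv_right]. *)
Lemma frac_deriv_left_reflect a b (s : R) phi x : a < b -> s < 1 -> a < x < b ->
  test_function `]a, b[ phi ->
  frac_deriv_left a s phi x =
  frac_deriv_right b s (reflect_fun (a + b) phi) (a + b - x).
Proof.
move=> ab s1 /andP[ax xb] tphi; have [sphi _ _] := tphi.
have trphi := test_function_reflect _ _ _ tphi.
have axb : a < a + b - x by lra.
rewrite /frac_deriv_left /frac_deriv_right.
have -> : frac_int_left a (1 - s) phi =
    reflect_fun (a + b) (frac_int_right b (1 - s) (reflect_fun (a + b) phi)).
  apply/funext => y; rewrite /reflect_fun -frac_int_left_reflect//.
  exact: smooth_measurable.
have df := is_derive_frac_int_right _ _ _ _ _ ab s1 axb trphi.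
have [_ drE] := is_derive_reflect _ _ _ _ df; have [_ dE] := df.
by rewrite !derive1E drE dE.
Qed.

Lemma frac_sobolev_left_reflect a b (s p : R) u : a < b -> 1 <= p -> s < 1 ->
  Lp_on `]a, b[ p u -> frac_sobolev_left a b s p (reflect_fun (a + b) u) ->
  frac_sobolev_right a b s p u.
Proof.
move=> ab p1 s1 Lu [Lru [v [_ _ vE] Lv]]; split => //.
have Lrv := Lp_on_reflect _ _ _ _ p1 Lv.
exists (reflect_fun (a + b) v) => //.
split; [exact: Lp_on_1 Lu|exact: Lp_on_locally_integrable Lrv|].
move=> phi tphi; have [sphi _ _] := tphi.
have trphi := test_function_reflect _ _ _ tphi; have [srphi _ _] := trphi.
have mphi : measurable_fun [set: mR] phi by exact: smooth_measurable.
have mu_ := Lp_on_measurable _ _ _ Lu; have mv := Lp_on_measurable _ _ _ Lv.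
rewrite (Rintegral_reflectM _ _ _ _ mv mphi) (vE _ trphi).
(* [Rintegral_reflectM] asks for measurability on the whole line; [D] is continuous there and agrees
   with the fractional derivative to the right of [a]. *)
pose D x := - ((Gamma (1 - s))^-1 * correlation (power_kernel s (b - a))
  (reflect_fun (a + b) phi)^`()%classic x).
have DE x : a < x -> frac_deriv_right b s (reflect_fun (a + b) phi) x = D x.
  by move=> ax; exact: frac_deriv_rightE.
have mD : measurable_fun [set: mR] D.
  apply: continuous_measurable_fun => x; apply: cvgN; apply: cvgM; first exact: cvg_cst.
  have ki : mu.-integrable setT (EFin \o power_kernel s (b - a)).
    by apply: integrable_power_kernel; rewrite ?subr_gt0.
  have := is_derive_correlation _ _ _ _ x (ltW ab) (smooth_derive1 _ srphi)
    (derive1_eq0_outside _ _ _ (fun x => test_function_eq0_cc _ _ _ x trphi)) ki.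
  by move=> [dc _]; apply/differentiable_continuous/derivable1_diffP.
transitivity (\int[mu]_(x in `]a, b[) (reflect_fun (a + b) u x * D x)).
  by apply: eq_Rintegral => x; rewrite inE/= in_itv/= => /andP[ax _]; rewrite DE.
rewrite (Rintegral_reflectM _ _ _ _ mu_ mD); apply: eq_Rintegral => x.
rewrite inE/= in_itv/= => /andP[ax xb]; rewrite (frac_deriv_left_reflect a b)//.
  by rewrite DE//; lra.
by rewrite ax.
Qed.

End reflection.

Theorem theorem5p16 (R : realType) (a b alpha p : R)
    (hab : a < b) (halpha0 : 0 < alpha) (halpha1 : alpha < 1)
    (hp : 1 <= p) (halphap : alpha * p < 1) :
  [/\ sobolev1 a b p `<=` frac_sobolev_left a b alpha p,
      sobolev1 a b p `<=` frac_sobolev_right a b alpha p &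
      sobolev1 a b p `<=` frac_sobolev a b alpha p].
Proof.
have left : sobolev1 a b p `<=` frac_sobolev_left a b alpha p.
  exact: sobolev1_frac_sobolev_left.
have right : sobolev1 a b p `<=` frac_sobolev_right a b alpha p.
  move=> u su; have [Lu _] := su.
  apply: frac_sobolev_left_reflect => //; apply: left.
  exact: sobolev1_reflect.
by split=> // u su; split; [exact: left|exact: right].
Qed.
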